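(* Let $k=\mathbb{C}$, let $A=k[\Gamma]$ be a monomial curve, and let $D=\mathrm{Diff}(A)$ be its $\mathbb{Z}$-graded ring of $k$-linear differential operators. Let $J^*=\{\alpha\in k:0\le\mathrm{Re}(\alpha)<1,\ \alpha\ne 0\}$. Then the extensions of $M_\beta$ by $M_\alpha$ in the category of graded holonomic left $D$-modules are given by $$\mathrm{Ext}^1_D(M_\alpha,M_\beta)_0=\begin{cases}k\xi\cong k, & (\alpha,\beta)=(0,\infty),(\infty,0),\\ k\xi\cong k, & \alpha=\beta\in J^*,\\ 0, & \text{otherwise}\end{cases}$$ for all simple graded $D$-modules $M_\alpha,M_\beta$ with $\alpha,\beta\in J^*\cup\{0,\infty\}$.
   Context: Let $k=\mathbb{C}$ and $\mathbb{N}_0=\{0,1,2,\dots\}$. Let $\Gamma\subseteq\mathbb{N}_0$ be a numerical semigroup, generated by positive integers without common factors, so that $\mathbb{N}_0\setminus\Gamma$ is finite; its semigroup algebra $A=k[\Gamma]=\bigoplus_{n\in\Gamma}k\,t^n\subseteq k[t]$ is called a monomial curve. Put $B=k[t]$, $T=k[t,t^{-1}]$ and $\partial=d/dt$. The ring $\mathrm{Diff}(T)=k[t,t^{-1}]\langle\partial\rangle$ is graded by letting $t^n\partial^m$ have degree $n-m$. The ring $D=\mathrm{Diff}(A)$ of $k$-linear differential operators on $A$ is identified with the graded subring $\{P\in\mathrm{Diff}(T):P(A)\subseteq A\}$ of $\mathrm{Diff}(T)$. The Euler derivation is $E=t\partial\in D$, and $\mathrm{Diff}(B)=A_1(k)=k\langle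 t,\partial\rangle$ is the first Weyl algebra. Graded left $D$-modules are $\mathbb{Z}$-graded, and their morphisms are the $D$-module homomorphisms that are homogeneous of degree zero; the twist $M[n]$ of a graded module $M$ has grading $M[n]_i=M_{n+i}$. The graded holonomic $D$-modules are the graded left $D$-modules of finite length. $\mathrm{Ext}^1_D(M,N)_0$ denotes the degree-zero part of the graded group $\mathrm{Ext}^1_D(M,N)$, and $k\xi$ denotes the one-dimensional $k$-vector space spanned by an extension class $\xi$. The simple graded left $D$-modules, up to graded isomorphisms and twists, are $M_0=A$; $M_\alpha=D/D\cdot(E-\alpha)$ for $\alpha\in J^*$; and $M_\infty=D(B,A)\otimes_{A_1(k)}V(0)$, where $V(0)=A_1(k)/A_1(k)\cdot t$ and $D(B,A)=\{P\in\mathrm{Diff}(T):P(B)\subseteq A\}$ is a graded $D$-$A_1(k)$ bimodule. Here $A$, the quotients and the tensor product carry their natural gradings. When $A=k[t]$ and $D=A_1(k)$, these are $M_0=D/D\partial$, $M_\alpha=D/D(E-\alpha)$ and $M_\infty=D/Dt$.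
   Formalization: M_∞ is replaced by its twist M_∞[1] (T/B when A = k[t]): with the natural grading on M_∞ the degree-zero Ext groups for (0,∞) and (∞,0) vanish, e.g. Ext¹(D/Dt, k[t])_0 = k[t]_1/t·k[t]_0 = 0, so the formula as stated fails. *)

(* Defs.v *)
From HB Require Import structures.
From mathcomp Require Import all_boot all_order all_algebra.
From mathcomp Require Import boolp classical_sets functions reals.
From mathcomp Require Import complex.

Set Implicit Arguments.
Unset Strict Implicit.
Unset Printing Implicit Defensive.

Import Order.TTheory GRing.Theory Num.Theory.
Local Open Scope ring_scope.

Section Laurent.
Variable k : fieldType.

Definition finite_support (f : int -> k^o) : bool :=
  `[< exists s : seq int, forall n, n \notin s -> f n = 0 >].

Lemma finite_support_submod : subsemimod_closed finite_support.
Proof.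
split; first split.
- by apply/asboolP; exists [::].
- move=> f g /asboolP [s hs] /asboolP [t ht]; apply/asboolP.
  exists (s ++ t) => n; rewrite mem_cat negb_or => /andP [/hs fn /ht gn].
  by rewrite addrfctE fn gn addr0.
- move=> c f /asboolP [s hs]; apply/asboolP; exists s => n /hs fn.
  by rewrite scalrfctE fn scaler0.
Qed.
HB.instance Definition _ := GRing.isSubmodClosed.Build k (int -> k^o)
  finite_support finite_support_submod.

(* k[t, t^-1], an element f being given by its coefficients: f n is that of t ^ n. *)
Record laurent := Laurent {lcoef :> int -> k^o; _ : finite_support lcoef}.
HB.instance Definition _ := [isSub for lcoef].
HB.instance Definition _ := [Choice of laurent by <:].
HB.instance Definition _ := [SubChoice_isSubLmodule of laurent by <:].

Lemma laurentP (f g : laurent) : (forall n, f n = g n) <-> f = g.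
Proof. by split=> [h|->//]; apply/val_inj/funext. Qed.

Lemma lcoefD (f g : laurent) n : (f + g) n = f n + g n. Proof. by []. Qed.
Lemma lcoefB (f g : laurent) n : (f - g) n = f n - g n. Proof. by []. Qed.
Lemma lcoefZ c (f : laurent) n : (c *: f) n = c * f n. Proof. by []. Qed.
Lemma lcoef0 n : (0 : laurent) n = 0. Proof. by []. Qed.
Lemma lcoef_sum I (s : seq I) (F : I -> laurent) n :
  (\sum_(i <- s) F i) n = \sum_(i <- s) F i n.
Proof. by elim/big_rec2: _ => // i x y _ <-. Qed.

Definition monom_fun (m : int) : int -> k^o := fun n => (n == m)%:R.
Lemma monom_subproof m : finite_support (monom_fun m).
Proof.
by apply/asboolP; exists [:: m] => n; rewrite inE /monom_fun => /negbTE ->.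
Qed.
Definition monom m := Laurent (monom_subproof m).

Definition is_linear (P : laurent -> laurent) : bool :=
  `[< forall c f g, P (c *: f + g) = c *: P f + P g >].

Lemma is_linear_submod : subsemimod_closed is_linear.
Proof.
split; first split.
- by apply/asboolP => c f g; rewrite scaler0 addr0.
- move=> P Q /asboolP hP /asboolP hQ; apply/asboolP => c f g.
  by rewrite !addrfctE hP hQ scalerDr addrACA.
- move=> a P /asboolP hP; apply/asboolP => c f g.
  by rewrite !scalrfctE hP scalerDr !scalerA mulrC.
Qed.
HB.instance Definition _ := GRing.isSubmodClosed.Build k (laurent -> laurent)
  is_linear is_linear_submod.

(* The k-algebra End_k(k[t, t^-1]), with composition as product. *)
Record lop := Lop {lop_fun :> laurent -> laurent; _ : is_linear lop_fun}.
HB.instance Definition _ := [isSub for lop_fun].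
HB.instance Definition _ := [Choice of lop by <:].
HB.instance Definition _ := [SubChoice_isSubLmodule of lop by <:].

Lemma lopP (P Q : lop) : (forall f, P f = Q f) <-> P = Q.
Proof. by split=> [h|->//]; apply/val_inj/funext. Qed.

Lemma lop_linear (P : lop) c f g : P (c *: f + g) = c *: P f + P g.
Proof. by case: P => P hP; move/asboolP: (hP); apply. Qed.
HB.instance Definition _ (P : lop) :=
  GRing.isLinear.Build k laurent laurent *:%R P (lop_linear P).

Lemma lopD (P Q : lop) f : (P + Q) f = P f + Q f. Proof. by []. Qed.
Lemma lopB (P Q : lop) f : (P - Q) f = P f - Q f. Proof. by []. Qed.
Lemma lopZ c (P : lop) f : (c *: P) f = c *: P f. Proof. by []. Qed.
Lemma lop0 f : (0 : lop) f = 0. Proof. by []. Qed.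
Lemma lop_sum I (s : seq I) (F : I -> lop) f :
  (\sum_(i <- s) F i) f = \sum_(i <- s) F i f.
Proof. by elim/big_rec2: _ => // i x y _ <-. Qed.

Lemma lop_one_subproof : is_linear id. Proof. exact/asboolP. Qed.
Lemma lop_mul_subproof (P Q : lop) : is_linear (P \o Q).
Proof. by apply/asboolP => c f g /=; rewrite !lop_linear. Qed.
Definition lop_one := Lop lop_one_subproof.
Definition lop_mul P Q := Lop (lop_mul_subproof P Q).

Lemma lop_mulA : associative lop_mul. Proof. by move=> P Q S; apply/lopP. Qed.
Lemma lop_mul1 : left_id lop_one lop_mul. Proof. by move=> P; apply/lopP. Qed.
Lemma lop_mulr1 : right_id lop_one lop_mul. Proof. by move=> P; apply/lopP. Qed.
Lemma lop_mulDl : left_distributive lop_mul +%R.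
Proof. by move=> P Q S; apply/lopP. Qed.
Lemma lop_mulDr : right_distributive lop_mul +%R.
Proof. by move=> P Q S; apply/lopP => f; rewrite lopD /= linearD. Qed.
Lemma lop_one_neq0 : lop_one != 0.
Proof.
apply/eqP => /lopP /(_ (monom 0)) /laurentP /(_ 0) /=.
by rewrite /monom_fun eqxx => /eqP; rewrite oner_eq0.
Qed.
HB.instance Definition _ := GRing.Zmodule_isNzRing.Build lop
  lop_mulA lop_mul1 lop_mulr1 lop_mulDl lop_mulDr lop_one_neq0.

Lemma lopM (P Q : lop) f : (P * Q) f = P (Q f). Proof. by []. Qed.
Lemma lop1 f : (1 : lop) f = f. Proof. by []. Qed.

Lemma lop_scalerAl (c : k) (P Q : lop) : c *: (P * Q) = (c *: P) * Q.
Proof. by apply/lopP. Qed.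
HB.instance Definition _ := GRing.Lmodule_isLalgebra.Build k lop lop_scalerAl.
Lemma lop_scalerAr (c : k) (P Q : lop) : c *: (P * Q) = P * (c *: Q).
Proof. by apply/lopP => f; rewrite lopM !lopZ lopM linearZ. Qed.
HB.instance Definition _ := GRing.Lalgebra_isAlgebra.Build k lop lop_scalerAr.

Lemma shift_subproof1 m (f : laurent) : finite_support (fun n => f (n - m)).
Proof.
case: f => f /= hf; move/asboolP: (hf) => [s hs]; apply/asboolP; exists [seq i + m | i <- s] => n hn /=.
apply: hs; apply: contra hn => h; apply/mapP; exists (n - m) => //.
by rewrite subrK.
Qed.
Lemma shift_subproof2 m : is_linear (fun f => Laurent (shift_subproof1 m f)).
Proof. by apply/asboolP => c f g; apply/laurentP. Qed.
(* Multiplication by t ^ m. *)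
Definition lshift m : lop := Lop (shift_subproof2 m).

Lemma deriv_subproof1 (f : laurent) :
  finite_support (fun n => (n + 1)%:~R * f (n + 1)).
Proof.
case: f => f /= hf; move/asboolP: (hf) => [s hs]; apply/asboolP; exists [seq i - 1 | i <- s] => n hn /=.
rewrite hs ?mulr0 //; apply: contra hn => h; apply/mapP; exists (n + 1) => //.
by rewrite addrK.
Qed.
Lemma deriv_subproof2 : is_linear (fun f => Laurent (deriv_subproof1 f)).
Proof.
apply/asboolP => c f g; apply/laurentP => n.
have E h m : Laurent (deriv_subproof1 h) m = (m + 1)%:~R * h (m + 1) by [].
by rewrite lcoefD lcoefZ !E lcoefD lcoefZ mulrDr mulrCA.
Qed.
Definition lderiv : lop := Lop deriv_subproof2.

(* Diff(k[t, t^-1]) = k[t, t^-1]<d/dt>, the subalgebra generated by t, t^-1, d/dt. *)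
Inductive diffT : lop -> Prop :=
| diffT_t : diffT (lshift 1)
| diffT_tV : diffT (lshift (- 1))
| diffT_d : diffT lderiv
| diffT_scal c : diffT (c%:A)
| diffT_add P Q : diffT P -> diffT Q -> diffT (P + Q)
| diffT_mul P Q : diffT P -> diffT Q -> diffT (P * Q).

(* Homogeneous elements of Diff(k[t, t^-1]), graded by deg (t ^ n (d/dt) ^ m) = n - m. *)
Inductive homT : int -> lop -> Prop :=
| homT_t : homT 1 (lshift 1)
| homT_tV : homT (- 1) (lshift (- 1))
| homT_d : homT (- 1) lderiv
| homT_scal c : homT 0 (c%:A)
| homT_zero i : homT i 0
| homT_add i P Q : homT i P -> homT i Q -> homT i (P + Q)
| homT_mul i j P Q : homT i P -> homT j Q -> homT (i + j) (P * Q).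

End Laurent.

(* V is the internal direct sum of the subgroups g i, i : int. *)
Record is_grading (V : zmodType) (g : int -> V -> Prop) : Prop := IsGrading {
  grading0 : forall i, g i 0;
  gradingB : forall i x y, g i x -> g i y -> g i (x - y);
  grading_sum : forall x, exists2 s : seq (int * V),
    (forall p, p \in s -> g p.1 p.2) & x = \sum_(p <- s) p.2;
  grading_direct : forall (s : seq int) (f : int -> V), uniq s ->
    (forall i, g i (f i)) -> \sum_(i <- s) f i = 0 -> forall i, i \in s -> f i = 0
}.

Lemma collapse (V : zmodType) (g : int -> V -> Prop) (s : seq (int * V)) :
  (forall i, g i 0) -> (forall i x y, g i x -> g i y -> g i (x + y)) ->
  (forall p, p \in s -> g p.1 p.2) ->
  exists f : int -> V, (forall i, g i (f i)) /\
    exists t, [/\ uniq t, forall i, i \notin t -> f i = 0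
                & \sum_(p <- s) p.2 = \sum_(i <- t) f i].
Proof.
move=> g0 gD gs; exists (fun i => \sum_(p <- s | p.1 == i) p.2); split.
  move=> i; rewrite big_seq_cond; apply: (big_ind (g i)) => //; first exact: gD.
  by move=> p /andP [ps /eqP <-]; exact: gs.
exists (undup [seq p.1 | p <- s]); split; first exact: undup_uniq.
  move=> i; rewrite mem_undup => hi; rewrite big_seq_cond big1 // => p /andP [ps /eqP pi].
  by case/negP: hi; apply/mapP; exists p.
rewrite (exchange_big_dep predT) //= big_seq [RHS]big_seq; apply: eq_bigr => p ps.
rewrite big_mkcond (bigD1_seq p.1) ?undup_uniq ?mem_undup /= ?eqxx //; last by apply/mapP; exists p.
by rewrite big1 ?addr0 // => i; rewrite eq_sym => /negbTE ->.
Qed.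

Section GradingTheory.
Variables (V : zmodType) (g : int -> V -> Prop).

Lemma grading_direct_of_proj (W : zmodType) (p : int -> V -> W) :
  (forall i, {morph p i : x y / x + y}) -> (forall i x, g i x -> p i x = 0 -> x = 0) ->
  (forall i j x, i != j -> g j x -> p i x = 0) ->
  forall (s : seq int) (f : int -> V), uniq s ->
    (forall i, g i (f i)) -> \sum_(i <- s) f i = 0 -> forall i, i \in s -> f i = 0.
Proof.
move=> pD pinj p0 s f us gf sf i si; apply: (pinj i) => //.
have pz : p i 0 = 0 by apply: (@addrI _ (p i 0)); rewrite -pD !addr0.
have := congr1 (p i) sf; rewrite (big_morph (p i) (pD i) pz) pz (bigD1_seq i) //=.
rewrite big1 ?addr0 // => j ji; apply: (p0 i j) => //; by rewrite eq_sym.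
Qed.

Hypothesis H : is_grading g.

Lemma gradingN i x : g i x -> g i (- x).
Proof. by move=> gx; rewrite -sub0r; apply: (gradingB H) => //; exact: grading0. Qed.
Lemma gradingD i x y : g i x -> g i y -> g i (x + y).
Proof. by move=> gx gy; rewrite -[y]opprK; apply: (gradingB H) => //; exact: gradingN. Qed.
Lemma gradingS i I (s : seq I) (P : pred I) F :
  (forall j, P j -> g i (F j)) -> g i (\sum_(j <- s | P j) F j).
Proof.
by move=> h; apply: (big_ind (g i)) => //; [exact: grading0 | exact: gradingD].
Qed.

Definition decomp (x : V) (f : int -> V) := (forall i, g i (f i)) /\
  exists s, [/\ uniq s, forall i, i \notin s -> f i = 0 & x = \sum_(i <- s) f i].

Lemma decomp_ex x : exists f, decomp x f.
Proof.
have [s gs ->] := grading_sum H x.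
by have [] := collapse (@grading0 _ _ H) gradingD gs; move=> f; exists f.
Qed.

Lemma big_widen (s t : seq int) (f : int -> V) : uniq s -> uniq t ->
  {subset s <= t} -> (forall i, i \notin s -> f i = 0) ->
  \sum_(i <- t) f i = \sum_(i <- s) f i.
Proof.
move=> us ut st f0; rewrite (bigID (mem s)) /= [X in _ + X]big1 ?addr0; last first.
  by move=> i; exact: f0.
rewrite -big_filter; apply: perm_big; apply: uniq_perm => //; first exact: filter_uniq.
by move=> i; rewrite mem_filter /=; case si: (i \in s) => //=; rewrite st.
Qed.

Lemma decomp_uniq x f f' : decomp x f -> decomp x f' -> f = f'.
Proof.
move=> [gf [s [us fs xs]]] [gf' [t [ut ft xt]]]; apply/funext => i.
pose u := undup (i :: s ++ t).
have su : {subset s <= u} by move=> j js; rewrite mem_undup inE mem_cat js orbT.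
have tu : {subset t <= u} by move=> j js; rewrite mem_undup inE mem_cat js !orbT.
apply/eqP; rewrite -subr_eq0; apply/eqP.
apply: (@grading_direct _ _ H u (fun i => f i - f' i)); rewrite ?undup_uniq //.
- by move=> j; apply: (gradingB H).
- rewrite sumrB (big_widen us _ su) ?undup_uniq // (big_widen ut _ tu) ?undup_uniq //.
  by rewrite -xs -xt subrr.
- by rewrite mem_undup inE eqxx.
Qed.

Definition hcomp (x : V) : int -> V := projT1 (cid (decomp_ex x)).
Lemma hcompP x : decomp x (hcomp x). Proof. exact: projT2 (cid (decomp_ex x)). Qed.
Lemma hcomp_eq x f : decomp x f -> hcomp x = f.
Proof. exact/decomp_uniq/hcompP. Qed.
Lemma hcomp_deg x i : g i (hcomp x i). Proof. by have [] := hcompP x. Qed.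
Lemma hcomp_sum x :
  exists s, [/\ uniq s, forall i, i \notin s -> hcomp x i = 0 & x = \sum_(i <- s) hcomp x i].
Proof. by have [] := hcompP x. Qed.
Lemma hcompD x y i : hcomp (x + y) i = hcomp x i + hcomp y i.
Proof.
have [s [us fs xs]] := hcomp_sum x; have [t [ut ft yt]] := hcomp_sum y.
rewrite (@hcomp_eq (x + y) (fun i => hcomp x i + hcomp y i)) //; split.
  by move=> j; apply: gradingD; exact: hcomp_deg.
exists (undup (s ++ t)); split; first exact: undup_uniq.
  by move=> j; rewrite mem_undup mem_cat negb_or => /andP [/fs -> /ft ->]; rewrite addr0.
have su : {subset s <= undup (s ++ t)} by move=> j h; rewrite mem_undup mem_cat h.
have tu : {subset t <= undup (s ++ t)} by move=> j h; rewrite mem_undup mem_cat h orbT.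
rewrite big_split /= (@big_widen s _ (hcomp x)) ?undup_uniq //.
by rewrite (@big_widen t _ (hcomp y)) ?undup_uniq // -xs -yt.
Qed.
Lemma hcomp_id x i j : g i x -> hcomp x j = if j == i then x else 0.
Proof.
move=> gx; rewrite (@hcomp_eq x (fun j => if j == i then x else 0)) //; split.
  by move=> l; case: eqP => [->//|_]; exact: grading0.
exists [:: i]; split=> //; last by rewrite big_seq1 eqxx.
by move=> l; rewrite inE => /negbTE ->.
Qed.
Lemma hcomp0 i : hcomp 0 i = 0.
Proof. by rewrite (@hcomp_id 0 i i) ?eqxx //; exact: grading0. Qed.
End GradingTheory.

Record gring (k : fieldType) := Gring {
  gr_sort :> algType k;
  gr_deg : int -> gr_sort -> Prop;
  gr_grading : is_grading gr_deg;
  gr_degA : forall c : k, gr_deg 0 c%:A;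
  gr_degM : forall i j a b, gr_deg i a -> gr_deg j b -> gr_deg (i + j) (a * b)
}.

Record gmod (k : fieldType) (D : gring k) := Gmod {
  gm_sort :> lmodType D;
  gm_deg : int -> gm_sort -> Prop;
  gm_grading : is_grading gm_deg;
  gm_degZ : forall i j a x, gr_deg i a -> gm_deg j x -> gm_deg (i + j) (a *: x)
}.

Section Twist.
Variables (k : fieldType) (D : gring k) (M : gmod D) (n : int).
(* M[n]_i = M_(n + i) *)
Definition twist_deg i : M -> Prop := gm_deg (n + i).
Lemma twist_grading : is_grading twist_deg.
Proof.
have H := gm_grading M; split.
- by move=> i; exact: (grading0 H).
- by move=> i x y; exact: (gradingB H).
- move=> x; have [s hs ->] := grading_sum H x.
  exists [seq (p.1 - n, p.2) | p <- s]; last by rewrite big_map.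
  by move=> _ /mapP [p ps ->] /=; rewrite /twist_deg addrC subrK; exact: hs.
- move=> s f us gf sf i si.
  have ninj : injective (fun i : int => n + i) by exact: addrI.
  have E j : f (n + j - n) = f j by rewrite addrAC subrr add0r.
  rewrite -E; apply: (@grading_direct _ _ H [seq n + i | i <- s] (fun i => f (i - n))).
  + by rewrite map_inj_uniq.
  + by move=> j; have := gf (j - n); rewrite /twist_deg addrC subrK.
  + by rewrite big_map -[RHS]sf; apply: eq_bigr => j _; exact: E.
  + exact: map_f.
Qed.
Lemma twist_degZ i j (a : D) (x : M) :
  gr_deg i a -> twist_deg j x -> twist_deg (i + j) (a *: x).
Proof. by move=> ai xj; rewrite /twist_deg addrCA; exact: gm_degZ. Qed.
Definition twist : gmod D := Gmod twist_grading twist_degZ.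
End Twist.

(* Graded submodules: D-submodules generated by homogeneous elements. *)
Definition is_gsub (k : fieldType) (D : gring k) (M : gmod D) (S : M -> Prop) :=
  [/\ S 0, forall (a : D) x y, S x -> S y -> S (a *: x + y)
    & forall x, S x -> exists2 s : seq (int * M),
        (forall p, p \in s -> gm_deg p.1 p.2 /\ S p.2) & x = \sum_(p <- s) p.2].

(* Finite length in the category of graded modules: existence of a composition
   series by graded submodules. *)
Definition finite_length (k : fieldType) (D : gring k) (M : gmod D) : Prop :=
  exists n (F : nat -> M -> Prop),
  [/\ forall i, is_gsub (F i), forall x, F 0%N x <-> x = 0, forall x, F n x
    & forall i, (i < n)%N ->
      [/\ forall x, F i x -> F i.+1 x, ~ (forall x, F i.+1 x -> F i x)
        & forall S, is_gsub S -> (forall x, F i x -> S x) -> (forall x, S x -> F i.+1 x) ->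
            (forall x, S x -> F i x) \/ (forall x, F i.+1 x -> S x)]].

Section Quotient.
Variables (k : fieldType) (D : gring k) (M : gmod D).
Record gsub := Gsub {gs_set :> M -> Prop; gs_subproof : is_gsub gs_set}.
Variable S : gsub.

Definition gs_pred : M -> bool := fun x => `[< S x >].
Lemma gs_predZ (a : D) x y : gs_pred x -> gs_pred y -> gs_pred (a *: x + y).
Proof. by have [_ h _] := gs_subproof S => /asboolP hx /asboolP hy; apply/asboolP/h. Qed.
Lemma gs_pred0 : gs_pred 0.
Proof. by have [h _ _] := gs_subproof S; apply/asboolP. Qed.
Lemma gs_zmod : zmod_closed gs_pred.
Proof.
split; first exact: gs_pred0.
by move=> x y hx hy; rewrite addrC -scaleN1r; exact: gs_predZ.
Qed.
HB.instance Definition _ := GRing.isZmodClosed.Build M gs_pred gs_zmod.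

Definition gs_zmodClosed := GRing.ZmodClosed.clone _ gs_pred _.
Definition gquot_type := Quotient.quot gs_zmodClosed.
HB.instance Definition _ := GRing.Zmodule.on gquot_type.
Definition gquot_pi (x : M) : gquot_type := (\pi_(Quotient.quot gs_zmodClosed) x)%qT.

Lemma gquot_piP x y : gquot_pi x = gquot_pi y <-> S (x - y).
Proof.
split=> [/eqP|h]; [|apply/eqP]; rewrite -Quotient.idealrBE.
  by move/asboolP.
by apply/asboolP.
Qed.
Lemma gquot_pi_surj q : exists x, q = gquot_pi x.
Proof. by exists (repr q); rewrite /gquot_pi reprK. Qed.
Lemma gquot_piD x y : gquot_pi (x + y) = gquot_pi x + gquot_pi y.
Proof. by rewrite /gquot_pi !piE. Qed.
Lemma gquot_piB x y : gquot_pi (x - y) = gquot_pi x - gquot_pi y.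
Proof. by rewrite /gquot_pi !piE. Qed.
Lemma gquot_pi0 : gquot_pi 0 = 0.
Proof. by rewrite -(subrr 0) gquot_piB subrr. Qed.
Lemma gquot_pi_sum I (s : seq I) F :
  gquot_pi (\sum_(i <- s) F i) = \sum_(i <- s) gquot_pi (F i).
Proof. exact: (big_morph _ gquot_piD gquot_pi0). Qed.

Definition gquot_scale (a : D) (q : gquot_type) : gquot_type :=
  gquot_pi (a *: repr q).
Lemma gquot_scale_pi a x : gquot_scale a (gquot_pi x) = gquot_pi (a *: x).
Proof.
apply/gquot_piP; rewrite -scalerBr.
suff h : S (repr (gquot_pi x) - x).
  by apply/asboolP; rewrite -[_ *: _]addr0; apply: gs_predZ; [exact/asboolP|exact: gs_pred0].
by apply/gquot_piP; rewrite /gquot_pi reprK.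
Qed.
Lemma gquot_scalerA a b q : gquot_scale a (gquot_scale b q) = gquot_scale (a * b) q.
Proof. by have [x ->] := gquot_pi_surj q; rewrite !gquot_scale_pi scalerA. Qed.
Lemma gquot_scale1r : left_id 1 gquot_scale.
Proof. by move=> q; have [x ->] := gquot_pi_surj q; rewrite gquot_scale_pi scale1r. Qed.
Lemma gquot_scalerDr : right_distributive gquot_scale +%R.
Proof.
move=> a q r; have [x ->] := gquot_pi_surj q; have [y ->] := gquot_pi_surj r.
by rewrite -gquot_piD !gquot_scale_pi scalerDr gquot_piD.
Qed.
Lemma gquot_scalerDl q : {morph gquot_scale^~ q : a b / a + b}.
Proof.
move=> a b; have [x ->] := gquot_pi_surj q.
by rewrite !gquot_scale_pi scalerDl gquot_piD.
Qed.
HB.instance Definition _ := GRing.Zmodule_isLmodule.Build D gquot_type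
  gquot_scalerA gquot_scale1r gquot_scalerDr gquot_scalerDl.

Definition gquot_deg i (q : gquot_type) : Prop := exists2 x, gm_deg i x & q = gquot_pi x.

Lemma gs_hcomp x i : S x -> S (hcomp (gm_grading M) x i).
Proof.
have [_ _ h] := gs_subproof S; move=> /h [s hs ->].
rewrite (big_morph (fun x => hcomp (gm_grading M) x i) (id1 := 0) (op1 := +%R)); first last.
- exact: hcomp0.
- by move=> ? ?; exact: hcompD.
apply/asboolP; rewrite big_seq; apply: (big_ind gs_pred).
- exact: gs_pred0.
- by move=> y z hy hz; rewrite -[y]scale1r; exact: gs_predZ.
- move=> p /hs [gp Sp]; rewrite (hcomp_id _ _ gp); case: eqP => _; apply/asboolP => //.
  exact/asboolP/gs_pred0.
Qed.

Lemma gquot_grading : is_grading gquot_deg.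
Proof.
have H := gm_grading M; split.
- by move=> i; exists 0; rewrite ?gquot_pi0 //; exact: grading0.
- move=> i _ _ [x gx ->] [y gy ->]; exists (x - y); rewrite ?gquot_piB //.
  exact: (gradingB H).
- move=> q; have [x ->] := gquot_pi_surj q; have [s hs ->] := grading_sum H x.
  exists [seq (p.1, gquot_pi p.2) | p <- s].
    by move=> _ /mapP [p ps ->] /=; exists p.2 => //; exact: hs.
  by rewrite gquot_pi_sum big_map.
- move=> s f us gf.
  have [h hP] : exists h, forall i, gm_deg i (h i) /\ f i = gquot_pi (h i).
    exists (fun i => s2val (cid2 (gf i))) => i; by split; [exact: s2valP (cid2 (gf i)) | exact: s2valP' (cid2 (gf i))].
  under eq_bigr do rewrite (hP _).2.
  rewrite -gquot_pi_sum => f0.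
  have /gquot_piP : gquot_pi (\sum_(i <- s) h i) = gquot_pi 0.
    by rewrite f0 gquot_pi0.
  rewrite subr0 => hS i si.
  rewrite (hP i).2; apply: (etrans _ gquot_pi0); apply/gquot_piP; rewrite subr0.
  have := gs_hcomp i hS.
  rewrite (@hcomp_eq _ _ (gm_grading M) _ (fun i => if i \in s then h i else 0)) ?si //; split.
    by move=> j; case: ifP => _; [exact: (hP j).1 | exact: grading0].
  exists s; split=> // [j /negbTE -> //|].
  by rewrite !big_seq; apply: eq_bigr => j ->.
Qed.
Lemma gquot_degZ i j (a : D) (q : gquot_type) :
  gr_deg i a -> gquot_deg j q -> gquot_deg (i + j) (a *: q).
Proof.
move=> ga [x gx ->]; exists (a *: x); first exact: gm_degZ.
exact: gquot_scale_pi.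
Qed.
Definition gquot : gmod D := Gmod gquot_grading gquot_degZ.
End Quotient.

Section Regular.
Variables (k : fieldType) (D : gring k).
Lemma greg_degZ i j (a : D) (x : D^o) :
  gr_deg i a -> gr_deg (g := D) j x -> gr_deg (g := D) (i + j) (a *: x).
Proof. exact: gr_degM. Qed.
Definition greg : gmod D :=
  @Gmod k D D^o (@gr_deg k D) (gr_grading D) greg_degZ.

Variables (d : int) (a : D).
Hypothesis ad : gr_deg d a.
Definition lideal_set (x : greg) : Prop := exists P : D, x = P * a.
Lemma lideal_gsub : is_gsub lideal_set.
Proof.
split.
- by exists 0; rewrite mul0r.
- by move=> b _ _ [P ->] [Q ->]; exists (b * P + Q); rewrite mulrDl -mulrA.
- move=> _ [P ->]; have [s hs ->] := grading_sum (gr_grading D) P.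
  exists [seq (p.1 + d, (p.2 * a : greg)) | p <- s].
    move=> _ /mapP [p ps ->] /=; split; last by exists p.2.
    by apply: gr_degM => //; exact: hs.
  by rewrite big_map mulr_suml.
Qed.
Definition lideal : gsub greg := Gsub lideal_gsub.
End Regular.

Lemma grading_ind (V : zmodType) (g : int -> V -> Prop) (Q : V -> Prop) :
  is_grading g -> Q 0 -> (forall x y, Q x -> Q y -> Q (x + y)) ->
  (forall i x, g i x -> Q x) -> forall x, Q x.
Proof.
move=> H Q0 QD Qh x; have [s gs ->] := grading_sum H x.
rewrite big_seq; apply: (big_ind Q) => // p /gs; exact: Qh.
Qed.

(* Graded D-E-bimodules: a graded left D-module with a commuting right action of E. *)
Record gbimod (k : fieldType) (D E : gring k) := Gbimod {
  gb_left :> gmod D;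
  gb_ract : gb_left -> E -> gb_left;
  gb_ractDl : forall a, {morph gb_ract^~ a : x y / x + y};
  gb_ractDr : forall x, {morph gb_ract x : a b / a + b};
  gb_ract1 : forall x, gb_ract x 1 = x;
  gb_ractA : forall x a b, gb_ract (gb_ract x a) b = gb_ract x (a * b);
  gb_ractZ : forall (c : D) x a, c *: gb_ract x a = gb_ract (c *: x) a;
  gb_degM : forall i j x a,
    gm_deg i x -> gr_deg j a -> gm_deg (i + j) (gb_ract x a)
}.

Section Tensor.
Variables (k : fieldType) (D E : gring k) (U : gbimod D E) (V : gmod E).

(* A formal sum (x1, v1) + ... + (xn, vn) is represented by the sequence of its
   terms. The quotient of formal sums by teq is the tensor product of U and V over
   E: since - (x (x) v) = (- x) (x) v, no formal negatives are needed. *)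
Inductive teq : seq (U * V) -> seq (U * V) -> Prop :=
| teq_refl s : teq s s
| teq_sym s t : teq s t -> teq t s
| teq_trans s t u : teq s t -> teq t u -> teq s u
| teq_cat s s' t t' : teq s s' -> teq t t' -> teq (s ++ t) (s' ++ t')
| teq_catC s t : teq (s ++ t) (t ++ s)
| teq_zero v : teq [:: (0, v)] [::]
| teq_addl x y v : teq [:: (x + y, v)] [:: (x, v); (y, v)]
| teq_addr x v w : teq [:: (x, v + w)] [:: (x, v); (x, w)]
| teq_bal x a v : teq [:: (gb_ract x a, v)] [:: (x, a *: v)].

Definition balanced (W : zmodType) (phi : U -> V -> W) :=
  [/\ forall x y v, phi (x + y) v = phi x v + phi y v,
      forall x v w, phi x (v + w) = phi x v + phi x w
    & forall x a v, phi (gb_ract x a) v = phi x (a *: v)].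

Lemma teq_lift (W : zmodType) (phi : U -> V -> W) s t : balanced phi -> teq s t ->
  \sum_(p <- s) phi p.1 p.2 = \sum_(p <- t) phi p.1 p.2.
Proof.
move=> [Dl Dr bal]; elim=> {s t} //.
- by move=> s t u _ -> _ ->.
- by move=> s s' t t' _ es _ et; rewrite !big_cat /= es et.
- by move=> s t; rewrite !big_cat /= addrC.
- by move=> v; rewrite big_seq1 big_nil /=; apply: (@addrI _ (phi 0 v)); rewrite -Dl !addr0.
- by move=> x y v; rewrite !big_cons !big_nil /= !addr0 Dl.
- by move=> x v w; rewrite !big_cons !big_nil /= !addr0 Dr.
- by move=> x a v; rewrite !big_seq1 /= bal.
Qed.

Definition teqb : rel (seq (U * V)) := fun s t => `[< teq s t >].
Lemma teqb_equiv : equiv_class_of teqb.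
Proof.
split=> [s|s t|t s u].
- exact/asboolP/teq_refl.
- by apply/asboolP/asboolP; exact: teq_sym.
- by move=> /asboolP a /asboolP b; apply/asboolP; exact: teq_trans a b.
Qed.
Canonical teqb_equivRel := EquivRelPack teqb_equiv.
Canonical teqb_encModRel := defaultEncModRel teqb.
Definition tensor_type := {eq_quot teqb}%qT.
HB.instance Definition _ := EqQuotient.on tensor_type.
HB.instance Definition _ := Choice.on tensor_type.
Definition tens (s : seq (U * V)) : tensor_type := (\pi_tensor_type s)%qT.

Lemma tensP s t : tens s = tens t <-> teq s t.
Proof.
split=> [/eqP|h]; first by rewrite piE => /asboolP.
by apply/eqP; rewrite piE; apply/asboolP.
Qed.
Lemma tens_surj q : exists s, q = tens s.
Proof. by exists (repr q); rewrite /tens reprK. Qed.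
Lemma tens_repr s : teq (repr (tens s)) s.
Proof. by apply/tensP; rewrite /tens reprK. Qed.

Definition tens_add (q r : tensor_type) := tens (repr q ++ repr r).
Definition tens_map (f : U -> U) (q : tensor_type) := tens [seq (f p.1, p.2) | p <- repr q].

Lemma tens_addE s t : tens_add (tens s) (tens t) = tens (s ++ t).
Proof. by apply/tensP/teq_cat; exact: tens_repr. Qed.

Lemma teq_map (f : U -> U) s t : {morph f : x y / x + y} ->
  (forall x a, f (gb_ract x a) = gb_ract (f x) a) -> teq s t ->
  teq [seq (f p.1, p.2) | p <- s] [seq (f p.1, p.2) | p <- t].
Proof.
move=> fD fR; elim=> {s t} /=.
- by move=> s; exact: teq_refl.
- by move=> s t _; exact: teq_sym.
- by move=> s t u _ a _ b; exact: teq_trans a b.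
- by move=> s s' t t' _ a _ b; rewrite !map_cat; exact: teq_cat.
- by move=> s t; rewrite !map_cat; exact: teq_catC.
- have -> : f 0 = 0 by apply: (@addrI _ (f 0)); rewrite -fD !addr0.
  by move=> v; exact: teq_zero.
- by move=> x y v; rewrite fD; exact: teq_addl.
- by move=> x v w; exact: teq_addr.
- by move=> x a v; rewrite fR; exact: teq_bal.
Qed.

Lemma tens_mapE (f : U -> U) s : {morph f : x y / x + y} ->
  (forall x a, f (gb_ract x a) = gb_ract (f x) a) ->
  tens_map f (tens s) = tens [seq (f p.1, p.2) | p <- s].
Proof. by move=> fD fR; apply/tensP/teq_map => //; exact: tens_repr. Qed.

Lemma gb_ract0l a : gb_ract (0 : U) a = 0.
Proof. by apply: (@addrI _ (gb_ract 0 a)); rewrite -gb_ractDl !addr0. Qed.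
Lemma gb_ractNl (x : U) a : gb_ract (- x) a = - gb_ract x a.
Proof. by apply: (@addrI _ (gb_ract x a)); rewrite -gb_ractDl !subrr gb_ract0l. Qed.

Let optE s : tens_map -%R (tens s) = tens [seq (- p.1, p.2) | p <- s].
Proof. by apply: tens_mapE => [x y|x a]; rewrite ?opprD ?gb_ractNl. Qed.

Lemma tens_addA : associative tens_add.
Proof.
move=> q r w; have [s ->] := tens_surj q; have [t ->] := tens_surj r.
by have [u ->] := tens_surj w; rewrite !tens_addE catA.
Qed.
Lemma tens_addC : commutative tens_add.
Proof.
move=> q r; have [s ->] := tens_surj q; have [t ->] := tens_surj r.
by rewrite !tens_addE; apply/tensP/teq_catC.
Qed.
Lemma tens_add0 : left_id (tens [::]) tens_add.
Proof. by move=> q; have [s ->] := tens_surj q; rewrite tens_addE. Qed.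
Lemma tens_addN : left_inverse (tens [::]) (tens_map -%R) tens_add.
Proof.
move=> q; have [s ->] := tens_surj q; rewrite optE tens_addE; apply/tensP.
elim: s => [|[x v] s IH] /=; first exact: teq_refl.
apply: (@teq_trans _ ([:: (- x, v)] ++ [:: (x, v)] ++ ([seq (- p.1, p.2) | p <- s] ++ s))).
  rewrite -cat1s; apply: teq_cat; first exact: teq_refl.
  rewrite -[(x, v) :: s]cat1s !catA; apply: teq_cat; last exact: teq_refl.
  exact: teq_catC.
rewrite catA -[X in teq _ X]cats0; apply: teq_cat => //.
apply: teq_trans (teq_zero v); apply: teq_sym; rewrite -(addNr x); exact: teq_addl.
Qed.
HB.instance Definition _ := GRing.isZmodule.Build tensor_type
  tens_addA tens_addC tens_add0 tens_addN.

Lemma tensD s t : tens s + tens t = tens (s ++ t).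
Proof. exact: tens_addE. Qed.
Lemma tensN s : - tens s = tens [seq (- p.1, p.2) | p <- s].
Proof. exact: optE. Qed.
Lemma tens0 : tens [::] = 0. Proof. by []. Qed.

Definition tens1 (x : U) (v : V) : tensor_type := tens [:: (x, v)].
Lemma tens1_balanced : balanced tens1.
Proof.
split=> *; rewrite ?tensD; apply/tensP; rewrite /=.
- exact: teq_addl.
- exact: teq_addr.
- exact: teq_bal.
Qed.
Lemma tensE s : tens s = \sum_(p <- s) tens1 p.1 p.2.
Proof.
elim: s => [|[x v] s IH]; first by rewrite big_nil.
by rewrite big_cons -IH /tens1 tensD.
Qed.

Lemma tens1_0l v : tens1 0 v = 0. Proof. exact/tensP/teq_zero. Qed.
Lemma tens1_0r x : tens1 x 0 = 0.
Proof.
have [_ Dr _] := tens1_balanced.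
by apply: (@addrI _ (tens1 x 0)); rewrite -Dr !addr0.
Qed.

Definition tens_scale (a : D) (q : tensor_type) : tensor_type := tens_map ( *:%R a) q.
Lemma tens_scaleE a s : tens_scale a (tens s) = tens [seq (a *: p.1, p.2) | p <- s].
Proof. by apply: tens_mapE => [x y|x b]; rewrite ?scalerDr ?gb_ractZ. Qed.
Lemma tens_scalerA a b q : tens_scale a (tens_scale b q) = tens_scale (a * b) q.
Proof.
have [s ->] := tens_surj q; rewrite !tens_scaleE -map_comp; congr tens.
by apply: eq_map => -[x v] /=; rewrite scalerA.
Qed.
Lemma tens_scale1r : left_id 1 tens_scale.
Proof.
move=> q; have [s ->] := tens_surj q; rewrite tens_scaleE; congr tens.
by rewrite -[RHS]map_id; apply: eq_map => -[x v] /=; rewrite scale1r.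
Qed.
Lemma tens_scalerDr : right_distributive tens_scale +%R.
Proof.
move=> a q r; have [s ->] := tens_surj q; have [t ->] := tens_surj r.
by rewrite tensD !tens_scaleE map_cat -tensD.
Qed.
Lemma tens_scalerDl q : {morph tens_scale^~ q : a b / a + b}.
Proof.
move=> a b; have [s ->] := tens_surj q; rewrite !tens_scaleE !tensE !big_map -big_split.
apply: eq_bigr => -[x v] _ /=; rewrite scalerDl.
by have [-> _ _] := tens1_balanced.
Qed.
HB.instance Definition _ := GRing.Zmodule_isLmodule.Build D tensor_type
  tens_scalerA tens_scale1r tens_scalerDr tens_scalerDl.

Definition tens_deg n (q : tensor_type) : Prop :=
  exists2 s : seq (U * V),
    forall p, p \in s -> exists i j, [/\ i + j = n, gm_deg i p.1 & gm_deg j p.2]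
  & q = \sum_(p <- s) tens1 p.1 p.2.

Definition tlift (W : zmodType) (phi : U -> V -> W) (q : tensor_type) : W :=
  \sum_(p <- repr q) phi p.1 p.2.
Lemma tliftE (W : zmodType) (phi : U -> V -> W) s : balanced phi ->
  tlift phi (tens s) = \sum_(p <- s) phi p.1 p.2.
Proof. by move=> hphi; apply: teq_lift => //; exact: tens_repr. Qed.
Lemma tliftD (W : zmodType) (phi : U -> V -> W) : balanced phi -> {morph tlift phi : x y / x + y}.
Proof.
move=> hphi q r; have [s ->] := tens_surj q; have [t ->] := tens_surj r.
by rewrite tensD !tliftE // big_cat.
Qed.

Let HU := gm_grading U.
Let HV := gm_grading V.
Let HE := gr_grading E.
Definition hsupp (x : U) := projT1 (cid (hcomp_sum HU x)).
Lemma hsuppP x : uniq (hsupp x) /\ forall i, i \notin hsupp x -> hcomp HU x i = 0.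
Proof. by have [] := projT2 (cid (hcomp_sum HU x)). Qed.

(* Candidate for the degree n component of the tensor of x and v. *)
Definition tproj n (x : U) (v : V) : tensor_type :=
  \sum_(i <- hsupp x) tens1 (hcomp HU x i) (hcomp HV v (n - i)).

Lemma tproj_widen n x v t : uniq t -> {subset hsupp x <= t} ->
  tproj n x v = \sum_(i <- t) tens1 (hcomp HU x i) (hcomp HV v (n - i)).
Proof.
have [us hs] := hsuppP x => ut st; apply/esym/big_widen => // i /hs ->.
exact: tens1_0l.
Qed.
Lemma tproj_hom n i j x v : gm_deg i x -> gm_deg j v ->
  tproj n x v = if i + j == n then tens1 x v else 0.
Proof.
move=> xi vj; rewrite (@tproj_widen _ _ _ (undup (i :: hsupp x))) ?undup_uniq //; last first.
  by move=> l hl; rewrite mem_undup inE hl orbT.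
rewrite (bigD1_seq i) ?undup_uniq ?mem_undup ?inE ?eqxx //= big1 ?addr0; last first.
  by move=> l /negbTE li; rewrite (hcomp_id HU _ xi) li tens1_0l.
rewrite (hcomp_id HU _ xi) eqxx (hcomp_id HV _ vj) subr_eq addrC eq_sym.
by case: eqP => // _; rewrite tens1_0r.
Qed.
Lemma tproj_Dl n x y v : tproj n (x + y) v = tproj n x v + tproj n y v.
Proof.
pose t := undup (hsupp (x + y) ++ hsupp x ++ hsupp y).
have st z : z \in [:: x + y; x; y] -> {subset hsupp z <= t}.
  by rewrite !inE => /or3P [] /eqP -> i hi; rewrite mem_undup !mem_cat hi ?orbT.
rewrite !(@tproj_widen _ _ _ t) ?undup_uniq //; try by apply: st; rewrite !inE eqxx ?orbT.
rewrite -big_split; apply: eq_bigr => i _ /=; rewrite hcompD.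
by have [-> _ _] := tens1_balanced.
Qed.
Lemma tproj_Dr n x v w : tproj n x (v + w) = tproj n x v + tproj n x w.
Proof.
rewrite -big_split; apply: eq_bigr => i _ /=; rewrite hcompD.
by have [_ -> _] := tens1_balanced.
Qed.
Lemma tproj_0l n v : tproj n 0 v = 0.
Proof. by apply: (@addrI _ (tproj n 0 v)); rewrite -tproj_Dl !addr0. Qed.
Lemma tproj_0r n x : tproj n x 0 = 0.
Proof. by apply: (@addrI _ (tproj n x 0)); rewrite -tproj_Dr !addr0. Qed.
Lemma tproj_balanced n : balanced (tproj n).
Proof.
split; [exact: tproj_Dl | exact: tproj_Dr |] => x a v.
move: x; apply: (grading_ind HU) => [|x y hx hy|i x xi].
- by rewrite gb_ract0l !tproj_0l.
- by rewrite gb_ractDl !tproj_Dl hx hy.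
move: v; apply: (grading_ind HV) => [|v w hv hw|j v vj].
- by rewrite scaler0 !tproj_0r.
- by rewrite scalerDr !tproj_Dr hv hw.
move: a; apply: (grading_ind HE) => [|a b ha hb|l a al].
- have -> : gb_ract x 0 = 0 by apply: (@addrI _ (gb_ract x 0)); rewrite -gb_ractDr !addr0.
  by rewrite scale0r tproj_0l tproj_0r.
- by rewrite gb_ractDr scalerDl tproj_Dl tproj_Dr ha hb.
rewrite (tproj_hom n (gb_degM xi al) vj) (tproj_hom n xi (gm_degZ al vj)) addrA.
by have [_ _ ->] := tens1_balanced.
Qed.

Lemma tens_grading : is_grading tens_deg.
Proof.
split.
- by move=> i; exists [::]; rewrite ?big_nil.
- move=> i _ _ [s hs ->] [t ht ->]; exists (s ++ [seq (- p.1, p.2) | p <- t]).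
    move=> p; rewrite mem_cat => /orP [/hs //|/mapP [r /ht [a [b [ab ra rb]]] ->]].
    by exists a, b; split=> //=; exact: (gradingN HU).
  by rewrite -!tensE tensN tensD.
- move=> q; have [s ->] := tens_surj q; rewrite tensE.
  pose Q q := exists2 s : seq (int * tensor_type),
    (forall p, p \in s -> tens_deg p.1 p.2) & q = \sum_(p <- s) p.2.
  have Q0 : Q 0 by exists [::]; rewrite ?big_nil.
  have QD x y : Q x -> Q y -> Q (x + y).
    move=> [a ha ->] [b hb ->]; exists (a ++ b); last by rewrite big_cat.
    by move=> p; rewrite mem_cat => /orP [/ha|/hb].
  have [Dl Dr _] := tens1_balanced.
  apply: (big_ind Q) => // -[x v] _ /=.
  move: x; apply: (grading_ind HU) => [|x y hx hy|i x xi]; rewrite ?tens1_0l ?Dl //; first exact: QD.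
  move: v; apply: (grading_ind HV) => [|v w hv hw|j v vj]; rewrite ?tens1_0r ?Dr //; first exact: QD.
  exists [:: (i + j, tens1 x v)]; last by rewrite big_seq1.
  move=> p; rewrite inE => /eqP -> /=; exists [:: (x, v)]; last by rewrite big_seq1.
  by move=> r; rewrite inE => /eqP ->; exists i, j.
- have tlE n m s : (forall p, p \in s ->
      exists i j, [/\ i + j = m, gm_deg i p.1 & gm_deg j p.2]) ->
      tlift (tproj n) (\sum_(p <- s) tens1 p.1 p.2) =
      if m == n then \sum_(p <- s) tens1 p.1 p.2 else 0.
    move=> hs; rewrite -tensE (tliftE _ (tproj_balanced n)) tensE.
    rewrite (fun_if (fun z => z)); case: (eqVneq m n) => mn.
      rewrite big_seq [RHS]big_seq; apply: eq_bigr => p /hs [i [j [ij pi pj]]].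
      by rewrite (tproj_hom n pi pj) ij mn eqxx.
    rewrite big_seq big1 // => p /hs [i [j [ij pi pj]]].
    by rewrite (tproj_hom n pi pj) ij (negbTE mn).
  apply: (@grading_direct_of_proj _ _ _ (fun n => tlift (tproj n))).
  + by move=> n; exact: (tliftD (tproj_balanced n)).
  + by move=> n _ [s hs ->]; rewrite (tlE _ _ _ hs) eqxx.
  + by move=> n m _ nm [s hs ->]; rewrite (tlE _ _ _ hs) eq_sym (negbTE nm).
Qed.
Lemma tens_degZ i j (a : D) (q : tensor_type) :
  gr_deg i a -> tens_deg j q -> tens_deg (i + j) (a *: q).
Proof.
move=> ai [s hs ->]; exists [seq (a *: p.1, p.2) | p <- s].
  move=> _ /mapP [r /hs [b [c [<- rb rc]]] ->]; exists (i + b), c; split=> //=.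
    by rewrite addrA.
  exact: gm_degZ.
by rewrite -!tensE; exact: tens_scaleE.
Qed.
Definition gtensor : gmod D := Gmod tens_grading tens_degZ.
End Tensor.

Lemma sub_grading (V : zmodType) (S : pred V) (U : subZmodType S) (g : int -> V -> Prop) :
  (forall i, g i 0) -> (forall i x y, g i x -> g i y -> g i (x - y)) ->
  (forall x, S x -> exists2 s : seq (int * V),
     (forall p, p \in s -> g p.1 p.2 /\ S p.2) & x = \sum_(p <- s) p.2) ->
  (forall (s : seq int) (f : int -> V), uniq s ->
    (forall i, g i (f i)) -> \sum_(i <- s) f i = 0 -> forall i, i \in s -> f i = 0) ->
  is_grading (fun i (u : U) => g i (val u)).
Proof.
move=> g0 gB gS gdir; split.
- by move=> i; rewrite raddf0.
- by move=> i x y; rewrite raddfB; exact: gB.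
- move=> x; have [s hs xs] := gS (val x) (valP x).
  exists [seq (p.1, insubd (0 : U) p.2) | p <- s].
    move=> _ /mapP [p /hs [gp Sp] ->] /=; by rewrite insubdK.
  apply: val_inj; rewrite xs raddf_sum big_map big_seq [RHS]big_seq.
  by apply: eq_bigr => p /hs [_ Sp] /=; rewrite insubdK.
- move=> s f us gf sf i si; apply: val_inj; rewrite raddf0.
  apply: (gdir s (fun i => val (f i))) => //.
  by rewrite -raddf_sum sf raddf0.
Qed.

Section Concrete.
Variable k : fieldType.
Notation laurent := (laurent k).
Notation lop := (lop k).

Lemma homT_diffT i (P : lop) : homT i P -> diffT P.
Proof.
elim=> {i P}.
- exact: diffT_t.
- exact: diffT_tV.
- exact: diffT_d.
- exact: diffT_scal.
- by move=> i; rewrite -(scale0r 1); exact: diffT_scal.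
- by move=> i P Q _ hP _ hQ; exact: diffT_add.
- by move=> i j P Q _ hP _ hQ; exact: diffT_mul.
Qed.

Lemma diffT_homT (P : lop) : diffT P ->
  exists2 s : seq (int * lop), (forall p, p \in s -> homT p.1 p.2) & P = \sum_(p <- s) p.2.
Proof.
have h1 i Q : homT i Q -> exists2 s : seq (int * lop),
    (forall p, p \in s -> homT p.1 p.2) & Q = \sum_(p <- s) p.2.
  move=> h; exists [:: (i, Q)]; last by rewrite big_seq1.
  by move=> p; rewrite inE => /eqP ->.
elim=> {P}.
- exact/h1/homT_t.
- exact/h1/homT_tV.
- exact/h1/homT_d.
- by move=> c; exact/h1/homT_scal.
- move=> P Q _ [s hs ->] _ [t ht ->]; exists (s ++ t); last by rewrite big_cat.
  by move=> p; rewrite mem_cat => /orP [/hs|/ht].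
- move=> P Q _ [s hs ->] _ [t ht ->].
  exists [seq (p.1 + q.1, p.2 * q.2) | p <- s, q <- t].
    move=> _ /allpairsP [[p q] /= [/hs hp /ht hq ->]] /=; exact: homT_mul.
  by rewrite big_allpairs_dep mulr_suml; apply: eq_bigr => p _; rewrite mulr_sumr.
Qed.

Lemma homT_local i (P : lop) : homT i P ->
  forall (f : laurent) n, f (n - i) = 0 -> P f n = 0.
Proof.
elim=> {i P} //.
- by move=> f n; rewrite opprK => h /=; rewrite h mulr0.
- by move=> c f n; rewrite subr0 => h; rewrite lopZ lop1 lcoefZ h mulr0.
- by move=> i P Q _ hP _ hQ f n h; rewrite lopD lcoefD hP ?hQ ?addr0.
- move=> i j P Q _ hP _ hQ f n h; rewrite lopM hP //; apply: hQ.
  by rewrite -addrA -opprD.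
Qed.

Lemma homTE i (P : lop) (f : laurent) n : homT i P ->
  P f n = f (n - i) * P (monom k (n - i)) n.
Proof.
move=> hP; have : P (f - (f (n - i) : k) *: monom k (n - i)) n = 0.
  apply: (homT_local hP); rewrite lcoefB lcoefZ /= /monom_fun eqxx mulr1.
  exact: subrr.
by rewrite linearB linearZ lcoefB lcoefZ => /eqP; rewrite subr_eq0 => /eqP.
Qed.

Lemma homTN i (P : lop) : homT i P -> homT i (- P).
Proof.
move=> h; rewrite -scaleN1r -[P]mul1r scalerAl -(add0r i); apply: homT_mul => //.
exact: homT_scal.
Qed.
Lemma homTB i (P Q : lop) : homT i P -> homT i Q -> homT i (P - Q).
Proof. by move=> hP hQ; apply: homT_add => //; exact: homTN. Qed.

Lemma homT_direct (s : seq int) (f : int -> lop) : uniq s ->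
  (forall i, homT i (f i)) -> \sum_(i <- s) f i = 0 -> forall i, i \in s -> f i = 0.
Proof.
apply: (@grading_direct_of_proj lop _ (int -> k^o)
  (fun i (P : lop) => (fun n => P (monom k n) (n + i)) : int -> k^o)).
- by move=> i P Q; apply/funext => n; rewrite addrfctE lopD lcoefD.
- move=> i P hP P0; apply/lopP => h; apply/laurentP => n.
  rewrite (homTE _ _ hP); have := congr1 (fun u => u (n - i)) P0.
  by rewrite /= subrK => ->; exact: mulr0.
- move=> i j P ij hP; apply/funext => n; apply: (homT_local hP).
  rewrite /= /monom_fun; case: eqP => // /eqP.
  by rewrite -addrA eq_sym addrC -subr_eq subrr eq_sym subr_eq0 (negbTE ij).
Qed.

(* f lies in k[S], the span of the t ^ m for m in S. *)
Definition lsupp (S : pred nat) (f : laurent) : bool :=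
  `[< forall n : int, f n != 0 -> exists2 m : nat, n = m%:Z & S m >].

Lemma lsupp_zmod S : zmod_closed (lsupp S).
Proof.
split; first by apply/asboolP => n; rewrite lcoef0 eqxx.
move=> f g /asboolP hf /asboolP hg; apply/asboolP => n; rewrite lcoefB => fg.
case: (eqVneq (f n) 0) => [f0|/hf //]; apply: hg.
by apply: contraNneq fg => g0; rewrite f0 g0 subr0.
Qed.
HB.instance Definition _ S := GRing.isZmodClosed.Build laurent (lsupp S) (lsupp_zmod S).

Record semialg S := Semialg {semialg_val :> laurent; _ : lsupp S semialg_val}.
HB.instance Definition _ S := [isSub for @semialg_val S].
HB.instance Definition _ S := [Choice of semialg S by <:].
HB.instance Definition _ S := [SubChoice_isSubZmodule of semialg S by <:].

(* P lies in D(k[S], k[S']), the differential operators P on k[t, t^-1] such that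
   P(k[S]) is contained in k[S']. *)
Definition is_dhom (S S' : pred nat) (P : lop) : bool :=
  `[< diffT P /\ forall f, lsupp S f -> lsupp S' (P f) >].

Lemma is_dhom_zmod S S' : zmod_closed (is_dhom S S').
Proof.
split.
  apply/asboolP; split; first exact: homT_diffT (homT_zero k 0).
  by move=> f _; exact: (lsupp_zmod S').1.
move=> P Q /asboolP [dP hP] /asboolP [dQ hQ]; apply/asboolP; split.
  apply: diffT_add => //; rewrite -scaleN1r -[Q]mul1r scalerAl; apply: diffT_mul => //.
  exact: diffT_scal.
by move=> f hf; apply: (lsupp_zmod S').2; [exact: hP | exact: hQ].
Qed.
HB.instance Definition _ S S' :=
  GRing.isZmodClosed.Build lop (is_dhom S S') (is_dhom_zmod S S').

Record dhom S S' := Dhom {dhom_val :> lop; _ : is_dhom S S' dhom_val}.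
HB.instance Definition _ S S' := [isSub for @dhom_val S S'].
HB.instance Definition _ S S' := [Choice of dhom S S' by <:].
HB.instance Definition _ S S' := [SubChoice_isSubZmodule of dhom S S' by <:].

Definition is_diff S := is_dhom S S.

Lemma is_dhomM S S' S'' (P Q : lop) :
  is_dhom S' S'' P -> is_dhom S S' Q -> is_dhom S S'' (P * Q).
Proof.
move=> /asboolP [dP hP] /asboolP [dQ hQ]; apply/asboolP; split; first exact: diffT_mul.
by move=> f /hQ /hP.
Qed.
Lemma is_diffA S c : is_diff S c%:A.
Proof.
apply/asboolP; split; first exact: diffT_scal.
move=> f /asboolP hf; apply/asboolP => n; rewrite lopZ lcoefZ lop1 mulf_eq0 negb_or.
by move=> /andP [_ /hf].
Qed.
Lemma is_diff_subalg S : GRing.subsemialg_closed (is_diff S).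
Proof.
have [d0 dB] := is_dhom_zmod S S.
split.
- by rewrite -(scale1r 1); exact: is_diffA.
- split=> // P Q hP hQ; rewrite -[Q]opprK; apply: (dB) => //.
  by rewrite -sub0r; exact: dB.
- by move=> c P hP; rewrite -[P]mul1r scalerAl; apply: is_dhomM hP; exact: is_diffA.
- by move=> P Q; exact: is_dhomM.
Qed.
HB.instance Definition _ S :=
  GRing.isSubalgClosed.Build k lop (is_diff S) (is_diff_subalg S).

(* Diff(k[S]); for S = predT this is the first Weyl algebra Diff(k[t]). *)
Record Diff S := DiffOp {diff_val :> lop; _ : is_diff S diff_val}.
HB.instance Definition _ S := [isSub for @diff_val S].
HB.instance Definition _ S := [Choice of Diff S by <:].
HB.instance Definition _ S := [SubChoice_isSubAlgebra of Diff S by <:].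

Lemma dhom_decomp S S' (P : lop) : is_dhom S S' P ->
  exists2 s : seq (int * lop), (forall p, p \in s -> homT p.1 p.2 /\ is_dhom S S' p.2)
    & P = \sum_(p <- s) p.2.
Proof.
move=> /asboolP [dP hP]; have [s hs Ps] := diffT_homT dP.
have [f [hf [t [ut ft Pt]]]] := collapse (@homT_zero k) (@homT_add k) hs.
exists [seq (i, f i) | i <- t]; last by rewrite Ps Pt big_map.
move=> _ /mapP [i it ->] /=; split => //; apply/asboolP; split.
  exact: homT_diffT (hf i).
move=> g /asboolP hg; apply/asboolP => n; rewrite (homTE _ _ (hf i)) mulf_eq0 negb_or.
move=> /andP [/hg [m nm Sm] fi]; have /hP /asboolP : lsupp S (monom k (n - i)).
  apply/asboolP => j; rewrite /= /monom_fun; case: (j =P n - i) => [-> _|]; last by rewrite eqxx.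
  by exists m.
apply; rewrite Ps Pt lop_sum lcoef_sum (bigD1_seq i) //= big1 ?addr0 // => j ji.
apply: (homT_local (hf j)); rewrite /= /monom_fun; case: eqP => // /addrI /oppr_inj jie.
by rewrite jie eqxx in ji.
Qed.

Definition diff_deg S i (P : Diff S) : Prop := homT i (val P).
Definition dhom_deg S S' i (P : dhom S S') : Prop := homT i (val P).
Lemma diff_grading S : is_grading (@diff_deg S).
Proof.
apply: (@sub_grading _ _ (Diff S) (@homT k)); [exact: homT_zero | exact: homTB | | exact: homT_direct].
exact: dhom_decomp.
Qed.
Lemma dhom_grading S S' : is_grading (@dhom_deg S S').
Proof.
apply: (@sub_grading _ _ (dhom S S') (@homT k)); [exact: homT_zero | exact: homTB | | exact: homT_direct].
exact: dhom_decomp.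
Qed.
Lemma diff_degA S (c : k) : diff_deg 0 (c%:A : Diff S).
Proof. exact: homT_scal. Qed.
Lemma diff_degM S i j (a b : Diff S) : diff_deg i a -> diff_deg j b -> diff_deg (i + j) (a * b).
Proof. exact: homT_mul. Qed.
Definition gDiff S : gring k := Gring (@diff_grading S) (@diff_degA S) (@diff_degM S).

Lemma semialg_act_subproof S (P : Diff S) (f : semialg S) : lsupp S (val P (val f)).
Proof. by case: P f => P hP [f hf]; move/asboolP: (hP) => [_]; apply. Qed.
Definition semialg_act S (P : Diff S) (f : semialg S) := Semialg (semialg_act_subproof P f).
Lemma semialg_scalerA S (P Q : Diff S) f : semialg_act P (semialg_act Q f) = semialg_act (P * Q) f.
Proof. exact: val_inj. Qed.
Lemma semialg_scale1r S : left_id 1 (@semialg_act S).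
Proof. by move=> f; exact: val_inj. Qed.
Lemma semialg_scalerDr S : right_distributive (@semialg_act S) +%R.
Proof. by move=> P f g; apply: val_inj => /=; rewrite linearD. Qed.
Lemma semialg_scalerDl S f : {morph (@semialg_act S)^~ f : a b / a + b}.
Proof. by move=> P Q; exact: val_inj. Qed.
HB.instance Definition _ S := GRing.Zmodule_isLmodule.Build (Diff S) (semialg S)
  (@semialg_scalerA S) (@semialg_scale1r S) (@semialg_scalerDr S) (@semialg_scalerDl S).

Definition lhom (i : int) (f : laurent) : Prop := forall n, n != i -> f n = 0.
Definition semialg_deg S i (f : semialg S) : Prop := lhom i (val f).
Lemma semialg_grading S : is_grading (@semialg_deg S).
Proof.
apply: (@sub_grading _ _ (semialg S) lhom).
- by [].
- by move=> i f g hf hg n ni; rewrite lcoefB hf ?hg ?subr0.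
- move=> f; case: f (f) => fv hfv f /asboolP hf.
  have [s hs] : exists s : seq int, uniq s /\ forall n, n \notin s -> f n = 0.
    case: f {hf} => f /= hf; move/asboolP: (hf) => [s hs]; exists (undup s).
    by rewrite undup_uniq; split=> // n; rewrite mem_undup; exact: hs.
  exists [seq (n, (f n : k) *: monom k n) | n <- s].
    move=> _ /mapP [n ns ->] /=; split.
      move=> m mn; rewrite lcoefZ /= /monom_fun (negbTE mn); exact: mulr0.
    apply/asboolP => m; rewrite lcoefZ /= /monom_fun; case: (m =P n) => [->|_].
      by rewrite mulr1 => /hf.
    by rewrite mulr0 eqxx.
  have E i n : ((f i : k) *: monom k i) n = (f i : k) * (n == i)%:R by [].
  rewrite big_map; apply/laurentP => n; rewrite lcoef_sum; case: hs => us hs.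
  case ns: (n \in s).
    rewrite (bigD1_seq n) // big1 ?addr0 ?E ?eqxx; first by rewrite [RHS]addr0 [RHS]mulr1.
    by move=> i /negbTE; rewrite eq_sym E => ->; exact: mulr0.
  rewrite hs ?ns // big1_seq // => i /andP [_ is_]; rewrite E.
  by case: (n =P i) => [ni|_]; [rewrite ni is_ in ns | exact: mulr0].
- apply: (@grading_direct_of_proj laurent lhom k^o (fun i (f : laurent) => f i)) => //.
    move=> i f hf fi; apply/laurentP => n; case: (eqVneq n i) => [->//|]; exact: hf.
  by move=> i j f ij; apply.
Qed.
Lemma semialg_degZ S i j (a : Diff S) (f : semialg S) :
  diff_deg i a -> semialg_deg j f -> semialg_deg (i + j) (a *: f).
Proof.
move=> ai fj n nij; apply: (homT_local ai); apply: fj.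
by apply: contra nij => /eqP <-; rewrite addrC subrK.
Qed.
Definition gsemialg S : gmod (gDiff S) :=
  @Gmod k (gDiff S) (semialg S) (@semialg_deg S) (@semialg_grading S) (@semialg_degZ S).

Section Bimodule.
Variables S S' : pred nat.
Lemma dhom_lact_subproof (P : Diff S') (Q : dhom S S') : is_dhom S S' (val P * val Q).
Proof. by case: P Q => P hP [Q hQ]; exact: is_dhomM hP hQ. Qed.
Definition dhom_lact P Q := Dhom (dhom_lact_subproof P Q).
Lemma dhom_ract_subproof (Q : dhom S S') (P : Diff S) : is_dhom S S' (val Q * val P).
Proof. by case: P Q => P hP [Q hQ]; exact: is_dhomM hQ hP. Qed.
Definition dhom_ract Q P := Dhom (dhom_ract_subproof Q P).

Lemma dhom_scalerA P Q f : dhom_lact P (dhom_lact Q f) = dhom_lact (P * Q) f.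
Proof. by apply: val_inj; exact: mulrA. Qed.
Lemma dhom_scale1r : left_id 1 dhom_lact.
Proof. by move=> f; apply: val_inj; exact: mul1r. Qed.
Lemma dhom_scalerDr : right_distributive dhom_lact +%R.
Proof. by move=> P f g; apply: val_inj; exact: mulrDr. Qed.
Lemma dhom_scalerDl f : {morph dhom_lact^~ f : a b / a + b}.
Proof. by move=> P Q; apply: val_inj; exact: mulrDl. Qed.
HB.instance Definition _ := GRing.Zmodule_isLmodule.Build (Diff S') (dhom S S')
  dhom_scalerA dhom_scale1r dhom_scalerDr dhom_scalerDl.

Lemma dhom_degZ i j (a : Diff S') (f : dhom S S') :
  diff_deg i a -> dhom_deg j f -> dhom_deg (i + j) (a *: f).
Proof. exact: homT_mul. Qed.
Definition gdhom_left : gmod (gDiff S') :=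
  @Gmod k (gDiff S') (dhom S S') (@dhom_deg S S') (@dhom_grading S S') dhom_degZ.

Lemma dhom_ractDl (a : gDiff S) :
  {morph (fun x : gdhom_left => dhom_ract x a : gdhom_left) : x y / x + y}.
Proof. by move=> x y; apply: val_inj; exact: mulrDl. Qed.
Lemma dhom_ractDr (x : gdhom_left) :
  {morph (fun a : gDiff S => dhom_ract x a : gdhom_left) : a b / a + b}.
Proof. by move=> a b; apply: val_inj; exact: mulrDr. Qed.
Lemma dhom_ract1 (x : gdhom_left) : dhom_ract x (1 : gDiff S) = x.
Proof. by apply: val_inj; exact: mulr1. Qed.
Lemma dhom_ractA (x : gdhom_left) (a b : gDiff S) :
  dhom_ract (dhom_ract x a) b = dhom_ract x (a * b).
Proof. by apply: val_inj; exact/esym/mulrA. Qed.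
Lemma dhom_ractZ (c : gDiff S') (x : gdhom_left) (a : gDiff S) :
  c *: (dhom_ract x a : gdhom_left) = dhom_ract (c *: x) a.
Proof. by apply: val_inj; exact: mulrA. Qed.
Lemma dhom_ract_deg i j (x : gdhom_left) (a : gDiff S) :
  gm_deg i x -> gr_deg j a -> gm_deg (g := gdhom_left) (i + j) (dhom_ract x a).
Proof. exact: homT_mul. Qed.
Definition gdhom : gbimod (gDiff S') (gDiff S) :=
  @Gbimod k (gDiff S') (gDiff S) gdhom_left dhom_ract
    dhom_ractDl dhom_ractDr dhom_ract1 dhom_ractA dhom_ractZ dhom_ract_deg.
End Bimodule.

Definition euler : lop := lshift k 1 * lderiv k.
Lemma eulerE f n : euler f n = n%:~R * f n.
Proof. by rewrite /euler lopM /= subrK. Qed.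
Lemma euler_subproof S : is_diff S euler.
Proof.
apply/asboolP; split; first exact: diffT_mul (diffT_t k) (diffT_d k).
move=> f /asboolP hf; apply/asboolP => n; rewrite eulerE => h; apply: hf.
by apply: contraNneq h => ->; rewrite mulr0.
Qed.
Definition Euler S : gDiff S := DiffOp (euler_subproof S).

Lemma Euler_deg S (a : k) : gr_deg (g := gDiff S) 0 (Euler S - a%:A).
Proof.
apply: homTB; last exact: homT_scal.
exact: (homT_mul (homT_t k) (homT_d k)).
Qed.

Lemma lshift1_subproof : is_diff predT (lshift k 1).
Proof.
apply/asboolP; split; first exact: diffT_t.
move=> f /asboolP hf; apply/asboolP => n /= /hf [m nm _].
by exists m.+1 => //; rewrite -[n](subrK 1) nm intS addrC.
Qed.
Definition tA1 : gDiff predT := DiffOp lshift1_subproof.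
Lemma tA1_deg : gr_deg (g := gDiff predT) 1 tA1.
Proof. exact: homT_t. Qed.

(* A_1 / A_1 t; the class of 1 has degree 0. *)
Definition V0 : gmod (gDiff predT) := gquot (lideal tA1_deg).
Definition M_zero (Gam : pred nat) : gmod (gDiff Gam) := gsemialg Gam.
Definition M_alpha (Gam : pred nat) (a : k) : gmod (gDiff Gam) :=
  gquot (lideal (Euler_deg Gam a)).
(* D(B, A) (x)_(A_1) V(0), with its natural grading: for A = k[t] it is D / D t with
   generator in degree 0. *)
Definition M_infty (Gam : pred nat) : gmod (gDiff Gam) := gtensor (gdhom predT Gam) V0.
End Concrete.

(* Degree-zero morphisms of graded modules. *)
Definition homog0 (k : fieldType) (D : gring k) (M N : gmod D) (f : M -> N) : Prop :=
  forall i x, gm_deg i x -> gm_deg i (f x).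

(* An object of Ext^1_D(M, N)_0: a short exact sequence 0 -> N -> X -> M -> 0 of
   graded left D-modules and morphisms homogeneous of degree zero. *)
Record gext (k : fieldType) (D : gring k) (M N : gmod D) := Gext {
  ext_mid : gmod D;
  ext_inj : {linear N -> ext_mid};
  ext_proj : {linear ext_mid -> M};
  ext_inj_homog : homog0 ext_inj;
  ext_proj_homog : homog0 ext_proj;
  ext_inj_injective : injective ext_inj;
  ext_proj_surjective : forall m, exists x, ext_proj x = m;
  ext_exact : forall x, ext_proj x = 0 <-> exists n, x = ext_inj n
}.

Section Ext1.
Variables (k : fieldType) (D : gring k) (M N : gmod D).
Implicit Types X Y Z : gext M N.

(* Congruence of extensions; such a morphism is automatically bijective. *)
Definition ext_equiv X Y : Prop :=
  exists f : {linear ext_mid X -> ext_mid Y},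
    [/\ homog0 f, forall n, f (ext_inj X n) = ext_inj Y n
      & forall x, ext_proj Y (f x) = ext_proj X x].

Definition ext_split X : Prop :=
  exists2 s : {linear M -> ext_mid X}, homog0 s & forall m, ext_proj X (s m) = m.

(* [Y] = c [X]: Y is the pushout of X along multiplication by the scalar c on N. *)
Definition ext_scale (c : k) X Y : Prop :=
  exists f : {linear ext_mid X -> ext_mid Y},
    [/\ homog0 f, forall n, f (ext_inj X n) = ext_inj Y ((c%:A : D) *: n)
      & forall x, ext_proj Y (f x) = ext_proj X x].

(* [Z] = [X] + [Y] (Baer sum): there is a degree-zero D-linear map from the fibre
   product of X and Y over M to Z that is the addition N x N -> N on the kernels
   and the identity on M. The map f is only constrained on the fibre product. *)
Definition ext_add X Y Z : Prop :=
  exists f : ext_mid X -> ext_mid Y -> ext_mid Z,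
    [/\ forall (a : D) x x' y y',
          ext_proj X x = ext_proj Y y -> ext_proj X x' = ext_proj Y y' ->
          f (a *: x + x') (a *: y + y') = a *: f x y + f x' y',
        forall i x y, ext_proj X x = ext_proj Y y ->
          gm_deg i x -> gm_deg i y -> gm_deg i (f x y),
        forall n n', f (ext_inj X n) (ext_inj Y n') = ext_inj Z (n + n')
      & forall x y, ext_proj X x = ext_proj Y y -> ext_proj Z (f x y) = ext_proj X x].

(* Ext^1_D(M, N)_0 = k xi is isomorphic to k: an isomorphism of vector spaces
   c |-> [e c] = c xi from k onto the classes of extensions, where xi = [e 1]. *)
Definition Ext1_isom_k : Prop :=
  exists e : k -> gext M N,
    [/\ forall X, exists c, ext_equiv (e c) X,
        forall a b, ext_equiv (e a) (e b) -> a = b,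
        forall a b, ext_add (e a) (e b) (e (a + b))
      & forall c a, ext_scale c (e a) (e (c * a))].

Definition Ext1_zero : Prop := forall X, ext_split X.
End Ext1.

Definition numerical_semigroup (Gam : pred nat) : Prop :=
  [/\ Gam 0%N, forall m n, Gam m -> Gam n -> Gam (m + n)%N
    & exists c : nat, forall n : nat, (c <= n)%N -> Gam n].

Definition Jstar (R : realType) (a : R[i]) : bool :=
  (0 <= complex.Re a < 1) && (a != 0).

(* The index set J* u {0, oo}. *)
Inductive simple_index (R : realType) : Type :=
| index_zero
| index_infty
| index_star (a : R[i]) of Jstar a.
Arguments index_zero {R}.
Arguments index_infty {R}.

(* Simple modules are classified up to twist, and M_infty is represented by the
   twist M_infty[1]. For A = k[t] this is k[t, t^-1] / k[t] with its usual grading, D / D t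
   with generator in degree -1. The normalization matters for Ext in degree zero: the
   Euler derivation minus the degree is an endomorphism of every graded module, with
   eigenvalue 0 on A and on M_infty[1], but - 1 on M_infty, so there are only split
   graded extensions between A and the untwisted M_infty. *)
Definition simple_module (R : realType) (Gam : pred nat) (i : simple_index R) :
    gmod (gDiff R[i] Gam) :=
  match i with
  | index_zero => M_zero R[i] Gam
  | index_infty => twist (M_infty R[i] Gam) 1
  | index_star a _ => M_alpha Gam a
  end.

Definition ext_nonzero (R : realType) (i j : simple_index R) : bool :=
  match i, j with
  | index_zero, index_infty | index_infty, index_zero => true
  | index_star a _, index_star b _ => a == b
  | _, _ => false
  end.

(* Main.v *)
From HB Require Import structures.
From mathcomp Require Import all_boot all_order all_algebra.
From mathcomp Require Import boolp classical_sets functions reals.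
From mathcomp Require Import complex.
From mathcomp Require Import ring zify.
Require Import Defs.

Set Implicit Arguments.
Unset Strict Implicit.
Unset Printing Implicit Defensive.

Import Order.TTheory GRing.Theory Num.Theory.
Local Open Scope ring_scope.

(** Every homogeneous operator has the form t ^ j phi(E), with E = t d/dt and phi a
    polynomial, and it preserves A = k[Gam] exactly when phi(m) = 0 for all m in Gam with
    m + j outside Gam. So the simple modules are all of one type (weighted): one line
    k e_i in each degree i of a set S, with t ^ j phi(E) e_i = phi(lam + i) e_(i + j).
    With T = k[t, t^-1], they are A (lam = 0, S = Gam), T / A, which is the twist of
    M_infty (lam = 0, S the complement of Gam), and t ^ alpha T (lam = alpha, S = Z); the
    identifications are weighted_M_zero, weighted_M_infty and weighted_M_alpha. Such a
    module is simple, hence generated by any e_b (w_gen, w_simple), and an extension of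
    two of them has length 2.

    An extension X with submodule N and cyclic quotient M = D m0 is determined by the map
    P |-> P x on the annihilator of m0, where x is a homogeneous lift of m0
    (ext_equiv_of_lifts, ext_split_of_lift). Conversely, an additive map h from D to N that is left linear on
    the annihilator of m0 gives the cocycle P, Q m0 |-> h(P Q) - P h(Q), and so a line of
    extensions c |-> c xi, for which the vector space operations can be written down on
    N x M (Ext1_isom_k_cyclic). The maps h that occur send t ^ j phi(E) to
    Delta(phi) e'_(b + j) for a linear functional Delta on polynomials.

    The operator E - degree is an endomorphism of every graded module, equal to lam on a
    weight module; hence extensions with different lam split. For lam = alpha the
    nilpotent part of this endomorphism is the only invariant, and Delta(phi) is
    phi'(alpha). For M = N = A and for M = N = T / A it vanishes, because E satisfies a
    polynomial with a simple root on a lift of e_b: a suitable operator leaves the set of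
    weights and another one comes back (weighted_self_Ext1_zero). Then the extension
    splits. For A and T / A all graded pieces of X are lines, and the operators from the
    degree b of the generator to a single degree of N decide everything
    (weighted_complementary_Ext1); here Delta(phi) is phi'(0) when the quotient
    is A and the submodule T / A, and phi(-1) when the quotient is T / A and the submodule
    A, where T itself is the nonsplit extension. *)

(** * Graded groups and graded modules *)

Lemma graded_additive_extension (V W : zmodType) (g : int -> V -> Prop)
    (H : is_grading g) (h : int -> V -> W) :
  (forall i x y, g i x -> g i y -> h i (x + y) = h i x + h i y) ->
  exists2 f : V -> W, {morph f : x y / x + y} & forall i x, g i x -> f x = h i x.
Proof.
move=> hD.
have h0 i : h i 0 = 0.
  by apply: (@addrI _ (h i 0)); rewrite -hD ?addr0 //; exact: grading0 H _.
pose supp x := projT1 (cid (hcomp_sum H x)).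
have suppP x : uniq (supp x) /\ forall i, i \notin supp x -> hcomp H x i = 0.
  by have [] := projT2 (cid (hcomp_sum H x)).
pose f x := \sum_(i <- supp x) h i (hcomp H x i).
have fE x t : uniq t -> {subset supp x <= t} -> f x = \sum_(i <- t) h i (hcomp H x i).
  have [us s0] := suppP x => ut st; apply/esym/big_widen => // i /s0 ->; exact: h0.
exists f => [x y|i x xi].
  pose t := undup (supp (x + y) ++ supp x ++ supp y).
  rewrite !(fE _ t) ?undup_uniq //; try by move=> i hi; rewrite mem_undup !mem_cat hi ?orbT.
  by rewrite -big_split; apply: eq_bigr => i _; rewrite hcompD hD //; exact: hcomp_deg.
rewrite (fE x (undup (i :: supp x))) ?undup_uniq //; last first.
  by move=> j hj; rewrite mem_undup inE hj orbT.
rewrite (bigD1_seq i) ?undup_uniq ?mem_undup ?inE ?eqxx //= big1 ?addr0.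
  by rewrite (hcomp_id H _ xi) eqxx.
by move=> j /negbTE ji; rewrite (hcomp_id H _ xi) ji h0.
Qed.

Section GradedModules.
Variables (k : fieldType) (D : gring k).

Lemma scalaryM (c : k) (a : D) : a * c%:A = c%:A * a.
Proof. by rewrite mulr_algl mulr_algr. Qed.

Lemma scalarCA (M : lmodType D) (c : k) (a : D) (x : M) :
  a *: (c%:A *: x) = c%:A *: (a *: x).
Proof. by rewrite !scalerA scalaryM. Qed.

Lemma scalarA (M : lmodType D) (a b : k) (x : M) :
  (a%:A : D) *: ((b%:A : D) *: x) = (a * b)%:A *: x.
Proof. by rewrite scalerA mulr_algl scalerA. Qed.

Lemma scalarI (M : lmodType D) (c : k) (x : M) :
  (c%:A : D) *: x = 0 -> c = 0 \/ x = 0.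
Proof.
move=> cx; case: (eqVneq c 0) => c0; [by left | right].
by rewrite -[x]scale1r -(scale1r (1 : D)) -(mulVf c0) -scalarA cx scaler0.
Qed.

(** Components of P m for m homogeneous: the component of P of degree i - b is the only
    one that contributes to degree i. *)
Lemma hcomp_scale (M : gmod D) b (m : M) (P : D) i : gm_deg b m ->
  hcomp (gm_grading M) (P *: m) i = hcomp (gr_grading D) P (i - b) *: m.
Proof.
move=> mb; rewrite (@hcomp_eq _ _ _ (P *: m)
  (fun i => hcomp (gr_grading D) P (i - b) *: m)) //; split.
  move=> j; rewrite -[j](subrK b) addrK.
  by apply: gm_degZ => //; exact: hcomp_deg.
have [s [us s0 Ps]] := hcomp_sum (gr_grading D) P.
exists [seq j + b | j <- s]; split.
- by rewrite map_inj_uniq //; exact: addIr.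
- move=> j js; rewrite s0 ?scale0r //; apply: contra js => js.
  by apply/mapP; exists (j - b); rewrite ?subrK.
- rewrite {1}Ps scaler_suml big_map; apply: eq_bigr => j _.
  by rewrite addrK.
Qed.

Lemma hcomp_homog0 (M N : gmod D) (f : {linear M -> N}) x i : homog0 f ->
  hcomp (gm_grading N) (f x) i = f (hcomp (gm_grading M) x i).
Proof.
move=> fh; rewrite (@hcomp_eq _ _ (gm_grading N) (f x)
  (fun j => f (hcomp (gm_grading M) x j))) //; split.
  by move=> j; apply: fh; exact: hcomp_deg.
have [s [us s0 xs]] := hcomp_sum (gm_grading M) x.
exists s; split=> // [j /s0 ->|]; first by rewrite linear0.
by rewrite {1}xs linear_sum.
Qed.

Lemma ann_hcomp (M : gmod D) b (m : M) (P : D) i : gm_deg b m ->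
  P *: m = 0 -> hcomp (gr_grading D) P i *: m = 0.
Proof.
move=> mb Pm; rewrite -[ i ](addrK b) -(hcomp_scale _ _ mb) Pm; exact: hcomp0.
Qed.

(** A homogeneous element of a cyclic graded module lifts to a homogeneous
    operator; this is what makes maps out of such a module homogeneous. *)
Lemma homogeneous_coordinate (M : gmod D) b (m : M) (P : D) i : gm_deg b m ->
  gm_deg i (P *: m) -> exists2 Q : D, gr_deg (i - b) Q & P *: m = Q *: m.
Proof.
move=> mb Pi; exists (hcomp (gr_grading D) P (i - b)); first exact: hcomp_deg.
by rewrite -(hcomp_scale _ _ mb) (hcomp_id _ _ Pi) eqxx.
Qed.

(** The annihilator of a homogeneous element is a graded left ideal, so an additive
    property of it need only be checked in each degree. *)
Lemma ann_graded_ind (M : gmod D) b (m : M) (R : D -> Prop) : gm_deg b m ->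
  R 0 -> (forall P Q, R P -> R Q -> R (P + Q)) ->
  (forall j P, gr_deg j P -> P *: m = 0 -> R P) ->
  forall P, P *: m = 0 -> R P.
Proof.
move=> mb R0 RD Rh P Pm; have [s [_ _ ->]] := hcomp_sum (gr_grading D) P.
apply: (big_ind R) => // i _; apply: Rh; first exact: hcomp_deg.
exact: ann_hcomp mb Pm.
Qed.

(** A submodule of V x W that projects bijectively to V is the graph of a linear map. *)
Lemma linear_of_relation (V W : lmodType D) (R : V -> W -> Prop) :
  (forall v, exists w, R v w) -> (forall w, R 0 w -> w = 0) ->
  (forall (a : D) v w v' w', R v w -> R v' w' -> R (a *: v + v') (a *: w + w')) ->
  exists f : {linear V -> W}, forall v w, R v w <-> w = f v.
Proof.
move=> Rtot R0 RL; pose f v := projT1 (cid (Rtot v)).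
have fP v : R v (f v) by exact: projT2 (cid (Rtot v)).
have Runiq v w w' : R v w -> R v w' -> w = w'.
  move=> h h'; apply/eqP; rewrite -subr_eq0 addrC -scaleN1r; apply/eqP/R0.
  by rewrite -(addNr v) -scaleN1r; exact: RL.
have fL : linear f.
  by move=> a v v'; apply: (@Runiq (a *: v + v')) => //; exact: RL.
pose fl : {linear V -> W} := HB.pack f (GRing.isLinear.Build D V W *:%R f fL).
exists fl => v w; split=> [h|->]; [exact: (Runiq v) | exact: fP].
Qed.
End GradedModules.

(** * Extensions of a cyclic graded module *)

Section CyclicExtensions.
Variables (k : fieldType) (D : gring k) (M N : gmod D).
Variables (b : int) (m0 : M).
Hypothesis m0b : gm_deg b m0.
Hypothesis m0gen : forall m, exists P : D, m = P *: m0.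
Implicit Types X Y : gext M N.

Lemma ext_proj_inj X n : ext_proj X (ext_inj X n) = 0.
Proof. by apply/ext_exact; exists n. Qed.

Lemma ext_projZ X (a : D) x : ext_proj X (a *: x) = a *: ext_proj X x.
Proof. exact: linearZ. Qed.

Lemma ext_injZ X (a : D) n : ext_inj X (a *: n) = a *: ext_inj X n.
Proof. exact: linearZ. Qed.

Lemma ext_lift_homog X i m : gm_deg i m ->
  exists2 x : ext_mid X, gm_deg i x & ext_proj X x = m.
Proof.
move=> mi; have [x xm] := ext_proj_surjective X m.
exists (hcomp (gm_grading _) x i); first exact: hcomp_deg.
rewrite -hcomp_homog0; last exact: ext_proj_homog.
by rewrite xm (hcomp_id _ _ mi) eqxx.
Qed.

Lemma ext_inj_homogV X i n : gm_deg i (ext_inj X n) -> gm_deg i n.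
Proof.
move=> ni; have -> : n = hcomp (gm_grading N) n i; last exact: hcomp_deg.
apply: (@ext_inj_injective _ _ _ _ X).
by rewrite -hcomp_homog0 ?(hcomp_id _ _ ni) ?eqxx //; exact: ext_inj_homog.
Qed.

Lemma ext_ker_homog X i x : gm_deg i x -> ext_proj X x = 0 ->
  exists2 n, gm_deg i n & x = ext_inj X n.
Proof.
move=> xi /ext_exact [n xn]; exists n => //.
by apply: (@ext_inj_homogV X); rewrite -xn.
Qed.

(** An extension is determined by the action of the annihilator of the generator on
    a homogeneous lift of it: this is the identification of Ext^1(D/I, N) with a
    quotient of Hom(I, N). *)
Lemma ext_equiv_of_lifts X Y (x : ext_mid X) (y : ext_mid Y) :
  gm_deg b x -> gm_deg b y -> ext_proj X x = m0 -> ext_proj Y y = m0 ->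
  (forall j (P : D), gr_deg j P -> P *: m0 = 0 ->
     exists n, P *: x = ext_inj X n /\ P *: y = ext_inj Y n) ->
  ext_equiv X Y.
Proof.
move=> xb yb xm ym hxy.
have {hxy} ann : forall P, P *: m0 = 0 -> exists n, P *: x = ext_inj X n /\ P *: y = ext_inj Y n.
  apply: (@ann_graded_ind _ _ M b m0 _ m0b _ _ hxy) => [|P1 P2 [n1 [e1 e1']] [n2 [e2 e2']]].
    by exists 0; rewrite !scale0r !linear0.
  by exists (n1 + n2); rewrite !scalerDl !linearD e1 e2 e1' e2'.
pose R (z : ext_mid X) (w : ext_mid Y) := exists P n,
  z = P *: x + ext_inj X n /\ w = P *: y + ext_inj Y n.
have Rtot_homog z i : gm_deg i z -> exists P n,
    [/\ gr_deg (i - b) P, gm_deg i n & z = P *: x + ext_inj X n].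
  move=> zi; have [P0 zP0] := m0gen (ext_proj X z).
  have zi' : gm_deg i (P0 *: m0) by rewrite -zP0; exact: ext_proj_homog.
  have [P Pi PE] := homogeneous_coordinate m0b zi'.
  have Pxi : gm_deg i (P *: x) by rewrite -[ i ](subrK b); exact: gm_degZ.
  have zPi : gm_deg i (z - P *: x) by exact: gradingB (gm_grading _) _ _ _ zi Pxi.
  have [|n ni zn] := ext_ker_homog zPi.
    by rewrite linearB linearZ /= xm zP0 PE subrr.
  by exists P, n; split=> //; rewrite -zn addrC subrK.
have Rtot z : exists w, R z w.
  have [P zP] := m0gen (ext_proj X z).
  have /ext_exact [n zn] : ext_proj X (z - P *: x) = 0.
    by rewrite linearB linearZ /= xm zP subrr.
  exists (P *: y + ext_inj Y n), P, n; split=> //.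
  by rewrite -zn addrC subrK.
have R0 w : R 0 w -> w = 0.
  move=> [P [n [z0 ->]]].
  have Pm : P *: m0 = 0.
    by move: (congr1 (ext_proj X) z0); rewrite linear0 linearD linearZ /= xm ext_proj_inj addr0.
  have [n' [ex ey]] := ann _ Pm; move: z0; rewrite ex ey -!linearD.
  by rewrite -{1}(linear0 (ext_inj X)) => /ext_inj_injective <-; rewrite linear0.
have RL (a : D) v w v' w' : R v w -> R v' w' -> R (a *: v + v') (a *: w + w').
  move=> [P [n [-> ->]]] [P' [n' [-> ->]]]; exists (a * P + P'), (a *: n + n').
  by rewrite !scalerDl !linearP !scalerDr !scalerA; split; rewrite addrACA.
have [f fP] := linear_of_relation Rtot R0 RL.
exists f; split.
- move=> i z zi; have [P [n [Pi ni zE]]] := Rtot_homog z i zi.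
  have <- : P *: y + ext_inj Y n = f z by apply/fP; exists P, n.
  apply: (gradingD (gm_grading _)); last exact: ext_inj_homog.
  by rewrite -[ i ](subrK b); exact: gm_degZ.
- by move=> n; apply/esym/fP; exists 0, n; rewrite !scale0r !add0r.
- move=> z; have /fP [P [n [-> ->]]] : f z = f z by [].
  by rewrite !linearD !linearZ /= xm ym !ext_proj_inj.
Qed.

Lemma ext_split_of_lift X (x : ext_mid X) :
  gm_deg b x -> ext_proj X x = m0 ->
  (forall j (P : D), gr_deg j P -> P *: m0 = 0 -> P *: x = 0) -> ext_split X.
Proof.
move=> xb xm hx.
have {hx} ann : forall P, P *: m0 = 0 -> P *: x = 0.
  apply: (@ann_graded_ind _ _ M b m0 _ m0b _ _ hx) => [|P1 P2 e1 e2]; first exact: scale0r.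
  by rewrite scalerDl e1 e2 addr0.
pose R m (w : ext_mid X) := exists P : D, m = P *: m0 /\ w = P *: x.
have [||| s sP] := @linear_of_relation _ _ _ _ R.
- by move=> m; have [P ->] := m0gen m; exists (P *: x), P.
- by move=> w [P [/esym /ann Px ->]].
- move=> a v w v' w' [P [-> ->]] [P' [-> ->]]; exists (a * P + P').
  by rewrite !scalerDl !scalerA.
exists s => [i m mi|m].
  have [P0 mP0] := m0gen m; rewrite mP0 in mi *.
  have [P Pi ->] := homogeneous_coordinate m0b mi.
  have <- : P *: x = s (P *: m0) by apply/sP; exists P.
  by rewrite -[ i ](subrK b); exact: gm_degZ.
by have /sP [P [-> ->]] : s m = s m by []; rewrite linearZ /= xm.
Qed.
End CyclicExtensions.

(** * The extension of a cocycle *)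

(** A homogeneous derivation of D with values in Hom_k(M, N). *)
Record cocycle (k : fieldType) (D : gring k) (M N : gmod D) := Cocycle {
  coc_fun :> D -> M -> N;
  cocDl : forall a a' m, coc_fun (a + a') m = coc_fun a m + coc_fun a' m;
  cocDr : forall a m m', coc_fun a (m + m') = coc_fun a m + coc_fun a m';
  cocM : forall a a' m, coc_fun (a * a') m = coc_fun a (a' *: m) + a *: coc_fun a' m;
  coc_deg : forall i j a m, gr_deg i a -> gm_deg j m -> gm_deg (i + j) (coc_fun a m)
}.

(** The cocycle is a phantom argument, so that each one gets its own D-module
    structure on N x M. *)
Definition coc_type (k : fieldType) (D : gring k) (M N : gmod D) (d : cocycle M N) : Type :=
  (N * M)%type.

Section CocycleExtension.
Variables (k : fieldType) (D : gring k) (M N : gmod D) (d : cocycle M N).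
HB.instance Definition _ := GRing.Zmodule.copy (coc_type d) (N * M)%type.

Definition coc_scale (a : D) (x : coc_type d) : coc_type d :=
  (a *: x.1 + d a x.2, a *: x.2).

Lemma coc1 m : d 1 m = 0.
Proof.
apply: (@addrI _ (d 1 m)); rewrite addr0.
by have := cocM d 1 1 m; rewrite mulr1 !scale1r => <-.
Qed.
Lemma coc_scalerA a a' x : coc_scale a (coc_scale a' x) = coc_scale (a * a') x.
Proof.
rewrite /coc_scale /= cocM !scalerA scalerDr scalerA.
by congr (_, _); rewrite -addrA; congr (_ + _); rewrite addrC.
Qed.
Lemma coc_scale1r : left_id 1 coc_scale.
Proof. by case=> n m; rewrite /coc_scale /= coc1 addr0 !scale1r. Qed.
Lemma coc_scalerDr : right_distributive coc_scale +%R.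
Proof.
move=> a [n m] [n' m']; rewrite /coc_scale /= !scalerDr cocDr.
by congr (_, _); rewrite addrACA.
Qed.
Lemma coc_scalerDl x : {morph coc_scale^~ x : a a' / a + a'}.
Proof.
move=> a a'; case: x => n m; rewrite /coc_scale /= !scalerDl cocDl.
by congr (_, _); rewrite addrACA.
Qed.
HB.instance Definition _ := GRing.Zmodule_isLmodule.Build D (coc_type d)
  coc_scalerA coc_scale1r coc_scalerDr coc_scalerDl.

Definition coc_gdeg i (x : coc_type d) : Prop := gm_deg i x.1 /\ gm_deg i x.2.

Lemma coc_grading : is_grading coc_gdeg.
Proof.
have HN := gm_grading N; have HM := gm_grading M; split.
- by move=> i; split; [exact: grading0 HN _ | exact: grading0 HM _].
- move=> i x y [x1 x2] [y1 y2]; split; [exact: gradingB HN _ _ _ x1 y1 | exact: gradingB HM _ _ _ x2 y2].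
- move=> [n m]; have [s hs ->] := grading_sum HN n; have [t ht ->] := grading_sum HM m.
  exists ([seq (p.1, (p.2, 0) : coc_type d) | p <- s] ++ [seq (p.1, (0, p.2) : coc_type d) | p <- t]).
    move=> p; rewrite mem_cat => /orP [] /mapP [q qs ->]; split=> /=.
    + exact: hs.
    + exact: grading0 HM _.
    + exact: grading0 HN _.
    + exact: ht.
  rewrite big_cat !big_map /=.
  have -> : \sum_(p <- s) ((p.2, 0) : coc_type d) = (\sum_(p <- s) p.2, 0).
    by elim/big_rec2: _ => // p x y _ ->; congr (_, _); rewrite addr0.
  have -> : \sum_(p <- t) ((0, p.2) : coc_type d) = (0, \sum_(p <- t) p.2).
    by elim/big_rec2: _ => // p x y _ ->; congr (_, _); rewrite addr0.
  by congr (_, _); rewrite ?addr0 ?add0r.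
- move=> s f us fs sf i si.
  have E : \sum_(j <- s) f j = (\sum_(j <- s) (f j).1, \sum_(j <- s) (f j).2).
    by elim/big_rec3: _ => // j x y z _ ->; case: (f j).
  move: sf; rewrite E => -[sf1 sf2].
  rewrite [f i]surjective_pairing; congr (_, _).
    exact: (grading_direct HN us (fun j => (fs j).1) sf1).
  exact: (grading_direct HM us (fun j => (fs j).2) sf2).
Qed.
Lemma coc_degZ i j (a : D) (x : coc_type d) :
  gr_deg i a -> coc_gdeg j x -> coc_gdeg (i + j) (a *: x).
Proof.
move=> ai [x1 x2]; split; last exact: gm_degZ.
by apply: (gradingD (gm_grading N)); [exact: gm_degZ | exact: coc_deg].
Qed.
Definition coc_mid : gmod D := @Gmod k D (coc_type d) coc_gdeg coc_grading coc_degZ.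

Lemma coc_inj_linear : linear (fun n => (n, 0) : coc_mid).
Proof.
move=> a n n'; rewrite /GRing.scale /= /coc_scale /= scaler0.
congr (_, _); last by rewrite addr0.
rewrite -[d a 0](_ : 0 = _) ?addr0 //.
by apply: (@addrI _ (d a 0)); rewrite -cocDr !addr0.
Qed.
Lemma coc_proj_linear : linear (fun x : coc_mid => x.2 : M).
Proof. by []. Qed.
Definition coc_inj : {linear N -> coc_mid} :=
  HB.pack (fun n => (n, 0) : coc_mid) (GRing.isLinear.Build D N coc_mid *:%R _ coc_inj_linear).
Definition coc_proj : {linear coc_mid -> M} :=
  HB.pack (fun x : coc_mid => x.2 : M) (GRing.isLinear.Build D coc_mid M *:%R _ coc_proj_linear).

Lemma coc_inj_homog : homog0 coc_inj.
Proof. by move=> i n ni; split=> //; exact: grading0 (gm_grading M) _. Qed.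
Lemma coc_proj_homog : homog0 coc_proj.
Proof. by move=> i x []. Qed.
Lemma coc_inj_injective : injective coc_inj.
Proof. by move=> n n' []. Qed.
Lemma coc_proj_surjective m : exists x, coc_proj x = m.
Proof. by exists (0, m). Qed.
Lemma coc_exact x : coc_proj x = 0 <-> exists n, x = coc_inj n.
Proof.
split=> [x0|[n ->] //]; exists x.1; rewrite [x]surjective_pairing.
by congr (_, _); exact: x0.
Qed.
Definition coc_ext : gext M N := Gext coc_inj_homog coc_proj_homog
  coc_inj_injective coc_proj_surjective coc_exact.
End CocycleExtension.

Section CocycleScaling.
Variables (k : fieldType) (D : gring k) (M N : gmod D) (d : cocycle M N).

Definition cocZ_fun (c : k) (a : D) (m : M) : N := (c%:A : D) *: d a m.
Lemma cocZ_Dl c a a' m : cocZ_fun c (a + a') m = cocZ_fun c a m + cocZ_fun c a' m.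
Proof. by rewrite /cocZ_fun cocDl scalerDr. Qed.
Lemma cocZ_Dr c a m m' : cocZ_fun c a (m + m') = cocZ_fun c a m + cocZ_fun c a m'.
Proof. by rewrite /cocZ_fun cocDr scalerDr. Qed.
Lemma cocZ_M c a a' m :
  cocZ_fun c (a * a') m = cocZ_fun c a (a' *: m) + a *: cocZ_fun c a' m.
Proof. by rewrite /cocZ_fun cocM scalerDr scalarCA. Qed.
Lemma cocZ_deg c i j a m : gr_deg i a -> gm_deg j m -> gm_deg (i + j) (cocZ_fun c a m).
Proof.
move=> ai mj; rewrite -[i + j]add0r; apply: gm_degZ; first exact: gr_degA.
exact: coc_deg.
Qed.
Definition cocZ c : cocycle M N := Cocycle (cocZ_Dl c) (cocZ_Dr c) (cocZ_M c) (@cocZ_deg c).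

Lemma coc_ext_add a b :
  ext_add (coc_ext (cocZ a)) (coc_ext (cocZ b)) (coc_ext (cocZ (a + b))).
Proof.
exists (fun x y => (x.1 + y.1, x.2)); split.
- move=> P x x' y y' /= xy xy'.
  rewrite -xy; apply: (congr2 pair) => //=.
  rewrite scalerDr /cocZ_fun (scalerDl 1 a b) scalerDl.
  by rewrite [LHS]addrACA [X in X + _]addrACA.
- move=> i x y /= xy [x1 x2] [y1 y2]; split=> //=.
  exact: (gradingD (gm_grading N)).
- by move=> n n' /=.
- by move=> x y xy.
Qed.

Lemma coc_ext_scale c a : ext_scale c (coc_ext (cocZ a)) (coc_ext (cocZ (c * a))).
Proof.
pose f (x : coc_type (cocZ a)) : coc_type (cocZ (c * a)) := ((c%:A : D) *: x.1, x.2).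
have fL : linear (f : coc_mid (cocZ a) -> coc_mid (cocZ (c * a))).
  move=> P x y; apply: (congr2 pair) => //=.
  by rewrite /cocZ_fun !scalerDr scalarA -(scalarCA c P).
pose fl : {linear coc_mid (cocZ a) -> coc_mid (cocZ (c * a))} :=
  HB.pack (f : coc_mid (cocZ a) -> coc_mid (cocZ (c * a)))
    (GRing.isLinear.Build D (coc_mid (cocZ a)) (coc_mid (cocZ (c * a))) *:%R _ fL).
exists fl; split=> // i x [x1 x2]; split=> //=.
by rewrite -[ i ]add0r; apply: gm_degZ => //; exact: gr_degA.
Qed.
End CocycleScaling.

(** * Extensions of a cyclic module from one map on the ring *)

Section CyclicCocycle.
Variables (k : fieldType) (D : gring k) (M N : gmod D).
Variables (b : int) (m0 : M).
Hypothesis m0b : gm_deg b m0.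
Hypothesis m0gen : forall m, exists P : D, m = P *: m0.
Variable h : D -> N.
Hypothesis hD : {morph h : P Q / P + Q}.
Hypothesis h_deg : forall j P, gr_deg j P -> gm_deg (j + b) (h P).
Hypothesis h_ann : forall P Q, Q *: m0 = 0 -> h (P * Q) = P *: h Q.

Let coord m : D := projT1 (cid (m0gen m)).
Let coordP m : m = coord m *: m0. Proof. exact: projT2 (cid (m0gen m)). Qed.

(** With m = Q m0, the failure of h to be left linear at Q; the choice of Q is
    immaterial because h is left linear on the annihilator of m0. *)
Definition cyc_fun (P : D) (m : M) : N := h (P * coord m) - P *: h (coord m).

Let hB P Q : h (P - Q) = h P - h Q.
Proof. by apply: (@addIr _ (h Q)); rewrite -hD !subrK. Qed.

Lemma cyc_funE P Q : cyc_fun P (Q *: m0) = h (P * Q) - P *: h Q.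
Proof.
have E : (Q - coord (Q *: m0)) *: m0 = 0 by rewrite scalerBl -coordP subrr.
have := h_ann P E; rewrite mulrBr !hB scalerBr /cyc_fun.
by move/eqP; rewrite subr_eq -addrA => /eqP ->; rewrite [RHS]addrC addKr addrC.
Qed.

Lemma cyc_funDl P P' m : cyc_fun (P + P') m = cyc_fun P m + cyc_fun P' m.
Proof. by rewrite /cyc_fun mulrDl hD scalerDl opprD addrACA. Qed.
Lemma cyc_funDr P m m' : cyc_fun P (m + m') = cyc_fun P m + cyc_fun P m'.
Proof.
rewrite {1}(coordP m) {1}(coordP m') -scalerDl cyc_funE.
by rewrite mulrDr !hD scalerDr opprD addrACA.
Qed.
Lemma cyc_funM P P' m : cyc_fun (P * P') m = cyc_fun P (P' *: m) + P *: cyc_fun P' m.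
Proof.
rewrite {2}(coordP m) scalerA cyc_funE /cyc_fun scalerBr !scalerA mulrA.
by rewrite [RHS]addrA subrK.
Qed.
Lemma cyc_fun_deg i j P m : gr_deg i P -> gm_deg j m -> gm_deg (i + j) (cyc_fun P m).
Proof.
move=> Pi; rewrite (coordP m) => mj.
have [Q Qj ->] := homogeneous_coordinate m0b mj; rewrite cyc_funE.
apply: (gradingB (gm_grading N)).
  by rewrite -[j](subrK b) addrA; apply: h_deg; exact: gr_degM.
by apply: gm_degZ => //; rewrite -[j](subrK b); exact: h_deg.
Qed.
Definition cyc_cocycle : cocycle M N := Cocycle cyc_funDl cyc_funDr cyc_funM cyc_fun_deg.

(** The lift of m0 on which the annihilator of m0 acts through c h. *)
Definition cyc_lift c : ext_mid (coc_ext (cocZ cyc_cocycle c)) := ((c%:A : D) *: h 1, m0).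

Lemma cyc_lift_deg c : gm_deg b (cyc_lift c).
Proof.
split=> //=; rewrite -[b]add0r; apply: gm_degZ; first exact: gr_degA.
by rewrite -[b]add0r; apply: h_deg; rewrite -(scale1r (1 : D)); exact: gr_degA.
Qed.

Lemma cyc_liftE c P n : P *: m0 = 0 ->
  P *: ((n, m0) : ext_mid (coc_ext (cocZ cyc_cocycle c))) =
  (P *: (n - (c%:A : D) *: h 1) + (c%:A : D) *: h P, 0).
Proof.
move=> Pm; apply: (congr2 pair) => //=.
rewrite /cocZ_fun /= -{1}(scale1r m0) cyc_funE mulr1.
rewrite [in RHS]scalerBr [X in _ + X = _]scalerBr -(scalarCA c P).
by rewrite -!addrA; congr (_ + _); rewrite addrC.
Qed.

(** The operator P of the first hypothesis reads off the scalar c of the class: changing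
    the lift of m0 by an element of N_b does not affect its value. *)
Lemma Ext1_isom_k_cyclic :
  (exists P : D, [/\ P *: m0 = 0, forall n : N, gm_deg b n -> P *: n = 0 & h P <> 0]) ->
  (forall X : gext M N, exists c (x : ext_mid X),
    [/\ gm_deg b x, ext_proj X x = m0
      & forall j P, gr_deg j P -> P *: m0 = 0 ->
          P *: x = ext_inj X ((c%:A : D) *: h P)]) ->
  Ext1_isom_k M N.
Proof.
move=> [P [Pm PN hP]] surj; exists (fun c => coc_ext (cocZ cyc_cocycle c)); split.
- move=> X; have [c [x [xb xm hx]]] := surj X; exists c.
  apply: (@ext_equiv_of_lifts _ _ _ _ _ _ m0b m0gen _ _ (cyc_lift c) x) => //.
    exact: cyc_lift_deg.
  move=> j Q Qj Qm; exists ((c%:A : D) *: h Q); split; last exact: hx Qj Qm.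
  by rewrite cyc_liftE // subrr scaler0 add0r.
- move=> a c [f [fh finj fproj]].
  have m0c : f (cyc_lift a) = ((f (cyc_lift a)).1, m0).
    rewrite [LHS]surjective_pairing; congr (_, _); exact: (fproj (cyc_lift a)).
  have /(congr1 f) : P *: cyc_lift a = ext_inj (coc_ext (cocZ cyc_cocycle a)) ((a%:A : D) *: h P).
    by rewrite cyc_liftE // subrr scaler0 add0r.
  rewrite finj linearZ /= m0c cyc_liftE // => -[].
  rewrite PN; last first.
    apply: (gradingB (gm_grading N)); last exact: (cyc_lift_deg c).1.
    by case: (fh _ _ (cyc_lift_deg a)).
  rewrite add0r => /eqP; rewrite eq_sym -subr_eq0 -scalerBl -scalerBl => /eqP /scalarI [] //.
  by move/eqP; rewrite subr_eq0 => /eqP.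
- by move=> a c; exact: coc_ext_add.
- by move=> c a; exact: coc_ext_scale.
Qed.
End CyclicCocycle.

(** * Homogeneous differential operators *)

Section HomogeneousOperators.
Variable k : fieldType.
Notation lop := (lop k).

(** The operator t ^ j phi(E), with E the Euler derivation. *)
Definition hop (j : int) (phi : {poly k}) : lop :=
  lshift k j * horner_alg (euler k) phi.

Lemma hopE j phi f n : hop j phi f n = phi.[(n - j)%:~R] * f (n - j) :> k.
Proof.
rewrite /hop lopM /=; move: (n - j) => m {n j}; elim/poly_ind: phi f => [|p c IH] f.
  by rewrite raddf0 lop0 lcoef0 horner0 mul0r.
have -> : horner_alg (euler k) (p * 'X + c%:P) = horner_alg (euler k) p * euler k + c%:A.
  by rewrite rmorphD rmorphM /= horner_algX horner_algC.
rewrite lopD lopM lcoefD IH eulerE.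
rewrite lopZ lop1 lcoefZ hornerMXaddC mulrDl.
by congr (_ + _); rewrite -mulrA.
Qed.

Lemma hopP j phi (P : lop) :
  (forall f n, P f n = phi.[(n - j)%:~R] * f (n - j) :> k) -> P = hop j phi.
Proof. by move=> h; apply/lopP => f; apply/laurentP => n; rewrite h hopE. Qed.

Lemma hop_monom j phi m : hop j phi (monom k m) (m + j) = phi.[m%:~R] :> k.
Proof. by rewrite hopE addrK /= /monom_fun eqxx mulr1. Qed.

Lemma hopD j phi psi : hop j phi + hop j psi = hop j (phi + psi).
Proof. by rewrite /hop rmorphD mulrDr. Qed.

Lemma hopM i j phi psi :
  hop i phi * hop j psi = hop (i + j) ((phi \Po ('X + j%:~R%:P)) * psi).
Proof.
apply: hopP => f n; rewrite lopM !hopE hornerM horner_comp hornerD hornerX hornerC mulrA.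
by rewrite -intrD opprD !addrA subrK.
Qed.

Lemma lshift_hop j : lshift k j = hop j 1.
Proof. by apply: hopP => f n; rewrite hornerC mul1r. Qed.

Lemma lderiv_hop : lderiv k = hop (- 1) 'X.
Proof. by apply: hopP => f n; rewrite hornerX opprK. Qed.

Lemma euler_hop : euler k = hop 0 'X.
Proof. by apply: hopP => f n; rewrite eulerE hornerX subr0. Qed.

Lemma scalar_hop c : c%:A = hop 0 c%:P :> lop.
Proof. by apply: hopP => f n; rewrite hornerC subr0. Qed.

Lemma hop_hom j phi : homT j (hop j phi).
Proof.
rewrite /hop -[X in homT X _]addr0; apply: homT_mul.
  have t0 : homT 0 (lshift k 0).
    by rewrite lshift_hop -[hop 0 1]scalar_hop; exact: homT_scal.
  have tD i i' : lshift k (i + i') = lshift k i * lshift k i'.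
    by rewrite !lshift_hop hopM comp_polyC mulr1.
  elim/int_rect: j => // n IH.
    by rewrite intS tD; apply: homT_mul (homT_t k) IH.
  by rewrite intS opprD tD; apply: homT_mul (homT_tV k) IH.
elim/poly_ind: phi => [|p c IH]; first by rewrite raddf0; exact: homT_zero.
rewrite rmorphD rmorphM /= horner_algX horner_algC.
apply: homT_add; last exact: homT_scal.
by rewrite -[0]addr0; apply: homT_mul IH _; exact: (homT_mul (homT_t k) (homT_d k)).
Qed.

Lemma homT_hop j (P : lop) : homT j P -> exists phi, P = hop j phi.
Proof.
elim=> {j P}.
- by exists 1; exact: lshift_hop.
- by exists 1; exact: lshift_hop.
- by exists 'X; exact: lderiv_hop.
- by move=> c; exists c%:P; exact: scalar_hop.
- by move=> i; exists 0; rewrite /hop raddf0 mulr0.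
- by move=> i P Q _ [phi ->] _ [psi ->]; exists (phi + psi); rewrite hopD.
- move=> i j P Q _ [phi ->] _ [psi ->].
  by exists ((phi \Po ('X + j%:~R%:P)) * psi); rewrite hopM.
Qed.

Hypothesis k_char0 : injective (fun n : int => n%:~R : k).

(** Two polynomials with the same operator agree on the integers, an infinite subset of
    k in characteristic 0. *)
Lemma hop_inj j : injective (hop j).
Proof.
move=> phi psi e; apply/eqP; rewrite -subr_eq0; apply/eqP.
pose s := [seq (n%:Z)%:~R : k | n <- iota 0 (size (phi - psi))].
apply: (@roots_geq_poly_eq0 _ _ s).
- apply/allP => _ /mapP [n _ ->]; rewrite /root !hornerE subr_eq0.
  by rewrite -!(hop_monom j) e.
- rewrite map_inj_uniq ?iota_uniq // => m n /k_char0; by case.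
- by rewrite size_map size_iota.
Qed.

Definition symb j (P : lop) : {poly k} := xget 0 [set phi | P = hop j phi]%classic.

Lemma symbK j phi : symb j (hop j phi) = phi.
Proof. by rewrite /symb; case: xgetP => [psi _ /hop_inj //|/(_ phi)]; case. Qed.
End HomogeneousOperators.

Definition memZ (S : pred nat) (n : int) : bool := if n is Posz m then S m else false.

Section Admissible.
Variable k : fieldType.
Hypothesis k_char0 : injective (fun n : int => n%:~R : k).

Definition admissible (S S' : pred nat) (j : int) (phi : {poly k}) : Prop :=
  forall m, memZ S m -> ~~ memZ S' (m + j) -> phi.[m%:~R] = 0.

Lemma lsuppP S (f : laurent k) : reflect (forall n, f n != 0 -> memZ S n) (lsupp S f).
Proof.
apply: (iffP (asboolP _)) => h n /h; first by case=> m ->.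
by case: n => // m; exists m.
Qed.

Lemma is_dhom_hop S S' j (phi : {poly k}) :
  is_dhom S S' (hop j phi) <-> admissible S S' j phi.
Proof.
split=> [/asboolP [_ h] m Sm Sj|h].
  have /h /lsuppP /(_ (m + j)) : lsupp S (monom k m).
    apply/lsuppP => n /=; rewrite /monom_fun; case: (n =P m) => [-> //|_].
    by rewrite eqxx.
  by rewrite hop_monom (negbTE Sj); case: eqP => // _ /(_ isT).
apply/asboolP; split; first exact: homT_diffT (hop_hom j phi).
move=> f /lsuppP hf; apply/lsuppP => n; rewrite hopE mulf_eq0 negb_or => /andP [p0 /hf Sn].
by apply: contraNT p0 => Sj; apply/eqP/h; rewrite ?subrK.
Qed.

(** The generator t ^ j chi(E) of the degree j part: chi has simple roots, exactly at
    the forbidden transitions m |-> m + j out of S'. *)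
Lemma minimal_admissible (S S' : pred nat) (c : nat) (j : int) :
  (forall n, (c <= n)%N -> S' n) ->
  exists chi, [/\ admissible S S' j chi,
    forall a, chi.[a] = 0 -> exists m, [/\ a = m%:~R, memZ S m & ~~ memZ S' (m + j)]
  & forall m, memZ S m -> ~~ memZ S' (m + j) -> chi^`().[m%:~R] != 0].
Proof.
move=> hc; pose P n := S n && ~~ memZ S' (Posz n + j).
pose s := [seq (n%:Z)%:~R : k | n <- iota 0 (c + `|j|) & P n].
have us : uniq s.
  rewrite map_inj_uniq; first by rewrite filter_uniq // iota_uniq.
  by move=> m n /k_char0; case.
have sP m : memZ S m -> ~~ memZ S' (m + j) -> m%:~R \in s.
  case: m => // n /= Sn Sj; apply: map_f; rewrite mem_filter /P Sn Sj mem_iota /=.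
  rewrite add0n; apply: contraNT Sj; rewrite -leqNgt => le.
  have -> : Posz n + j = Posz (absz (Posz n + j)) by lia.
  by apply: hc; lia.
exists (\prod_(a <- s) ('X - a%:P)); split.
- by move=> m Sm Sj; apply/eqP/negbNE; rewrite negbK -/(root _ _) root_prod_XsubC sP.
- move=> a /eqP; rewrite -/(root _ _) root_prod_XsubC => /mapP [n].
  by rewrite mem_filter => /andP [/andP [Sn Sj] _] ->; exists n.
- move=> m Sm Sj; rewrite (bigD1_seq m%:~R) ?sP //= derivM !derivE !hornerE.
  rewrite subrr mul0r addr0 -big_filter -/(root _ _) root_prod_XsubC.
  by rewrite mem_filter eqxx.
Qed.
End Admissible.

(** * Weight modules *)

Section Symbols.
Variable k : fieldType.
Hypothesis k_char0 : injective (fun n : int => n%:~R : k).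
Variable Gam : pred nat.
Notation D := (gDiff k Gam).

Definition symbol (P : D) (j : int) (phi : {poly k}) : Prop := diff_val P = hop j phi.

Lemma symbol_deg P j phi : symbol P j phi -> gr_deg j P.
Proof. by move=> h; rewrite /= /diff_deg /= h; exact: hop_hom. Qed.

Lemma deg_symbol (P : D) j : gr_deg j P -> exists phi, symbol P j phi.
Proof. exact: homT_hop. Qed.

Lemma symbol_ex j phi : admissible Gam Gam j phi -> exists P, symbol P j phi.
Proof. by move=> /is_dhom_hop h; exists (DiffOp h). Qed.

Lemma symbol_adm P j phi : symbol P j phi -> admissible Gam Gam j phi.
Proof. by move=> h; apply/is_dhom_hop; rewrite -h; exact: valP P. Qed.

Lemma symbol_ex0 phi : exists P, symbol P 0 phi.
Proof. by apply: symbol_ex => m; rewrite addr0 => ->. Qed.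

Lemma symbolM P Q i j phi psi : symbol P i phi -> symbol Q j psi ->
  symbol (P * Q) (i + j) ((phi \Po ('X + j%:~R%:P)) * psi).
Proof. by rewrite /symbol => hP hQ; rewrite -hopM -hP -hQ. Qed.

Lemma symbolD P Q j phi psi : symbol P j phi -> symbol Q j psi ->
  symbol (P + Q) j (phi + psi).
Proof. by rewrite /symbol => hP hQ; rewrite -hopD -hP -hQ. Qed.

Lemma symbol_scalar (c : k) : symbol c%:A 0 c%:P.
Proof. exact: scalar_hop. Qed.

Lemma symbol_euler a : symbol (Euler k Gam - a%:A) 0 ('X - a%:P).
Proof.
rewrite -polyCN; apply: symbolD; first exact: euler_hop.
by rewrite -scaleNr; exact: symbol_scalar.
Qed.

Lemma symbol_inj P Q j phi : symbol P j phi -> symbol Q j phi -> P = Q.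
Proof. by move=> hP hQ; apply: val_inj; rewrite /= hP hQ. Qed.

Lemma symbol_eq P j j' phi phi' : symbol P j phi -> j = j' -> phi = phi' -> symbol P j' phi'.
Proof. by move=> h <- <-. Qed.

Lemma symbM P Q i j phi psi : symbol P i phi -> symbol Q j psi ->
  symb (i + j) (diff_val (P * Q)) = (phi \Po ('X + j%:~R%:P)) * psi.
Proof. by move=> hP hQ; rewrite (symbolM hP hQ) symbK. Qed.

Lemma poly_factor (phi : {poly k}) a : phi.[a] = 0 ->
  exists q, phi = q * ('X - a%:P) /\ phi^`().[a] = q.[a].
Proof.
move=> /eqP; rewrite -/(root _ _) => /factor_theorem [q ->]; exists q; split=> //.
by rewrite derivM !derivE !hornerE subrr mulr0 add0r.
Qed.

Lemma comp_poly_shift0 (phi : {poly k}) : phi \Po ('X + (0 : int)%:~R%:P) = phi.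
Proof. by rewrite addr0 comp_polyXr. Qed.

(** D(E - a) contains every homogeneous operator that kills t ^ a, unless the factor
    E - a is what makes t ^ j phi(E) preserve k[Gam]. *)
Lemma euler_factor P j phi a : symbol P j phi -> phi.[a] = 0 ->
  (forall m, a = m%:~R -> memZ Gam m -> memZ Gam (m + j)) ->
  exists Q q, [/\ symbol Q j q, P = Q * (Euler k Gam - a%:A) & phi^`().[a] = q.[a]].
Proof.
move=> hP /poly_factor [q [qE q1]] ha; have [Q hQ] : exists Q, symbol Q j q.
  apply: symbol_ex => m Gm Gj; move/eqP: (symbol_adm hP Gm Gj).
  rewrite qE hornerM !hornerE mulf_eq0 => /orP [/eqP //|].
  by rewrite subr_eq0 => /eqP /esym /ha /(_ Gm); rewrite (negbTE Gj).
exists Q, q; split=> //.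
apply: symbol_inj hP _; apply: symbol_eq (symbolM hQ (symbol_euler a)) (addr0 j) _.
by rewrite comp_poly_shift0.
Qed.

(** The degree 0 part of D is k[E], and phi - phi(a) is a multiple of X - a. *)
Lemma euler_eigen (X : lmodType D) (x : X) a P phi :
  (Euler k Gam - a%:A) *: x = 0 -> symbol P 0 phi -> P *: x = (phi.[a])%:A *: x.
Proof.
move=> xa hP; have [|q [qE _]] := @poly_factor (phi - phi.[a]%:P) a.
  by rewrite !hornerE subrr.
have [Q hQ] := symbol_ex0 q.
suff -> : P = Q * (Euler k Gam - a%:A) + (phi.[a])%:A.
  by rewrite scalerDl -scalerA xa scaler0 add0r.
apply: (symbol_inj hP); have := symbolD (symbolM hQ (symbol_euler a)) (symbol_scalar phi.[a]).
by rewrite comp_poly_shift0 -qE subrK.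
Qed.

(** The modules t ^ lam k[t, t^-1] and their subquotients with set of weights
    lam + S, in an abstract form: one line in each degree of S, on which t ^ j phi(E)
    acts through phi(lam + i); w_conn makes such a module simple. *)
Record weighted (M : gmod D) (lam : k) (S : pred int) (e : int -> M) : Prop := Weighted {
  w_deg : forall i, gm_deg i (e i);
  w_span : forall i x, gm_deg i x -> exists c : k, x = (c%:A : D) *: e i;
  w_supp : forall i, S i <-> e i <> 0;
  w_act : forall P j phi i, symbol P j phi -> S i ->
    P *: e i = ((phi.[lam + i%:~R])%:A : D) *: e (i + j);
  w_conn : forall i i', S i -> S i' ->
    exists P phi, symbol P (i' - i) phi /\ phi.[lam + i%:~R] != 0;
  w_inh : exists i, S i
}.

Section WeightTheory.
Variables (M : gmod D) (lam : k) (S : pred int) (e : int -> M).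
Hypothesis W : weighted lam S e.

Lemma w_out i : ~~ S i -> e i = 0.
Proof. by move=> Si; apply: contrapT => /(w_supp W); rewrite (negbTE Si). Qed.

Lemma w_zero i (x : M) : ~~ S i -> gm_deg i x -> x = 0.
Proof. by move=> Si /(w_span W) [c ->]; rewrite w_out // scaler0. Qed.

Lemma w_act_deg i (x : M) P phi : gm_deg i x -> symbol P 0 phi ->
  P *: x = ((phi.[lam + i%:~R])%:A : D) *: x.
Proof.
move=> xi hP; have [Si|Si] := boolP (S i); last by rewrite (w_zero Si xi) !scaler0.
have [c ->] := w_span W xi; rewrite scalarCA (w_act W hP Si) addr0.
by rewrite !scalarA mulrC.
Qed.

Lemma w_kill P j phi i : symbol P j phi -> S i -> S (i + j) -> P *: e i = 0 ->
  phi.[lam + i%:~R] = 0.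
Proof. by move=> hP Si /(w_supp W) h; rewrite (w_act W hP Si) => /scalarI []. Qed.

Lemma w_gen b : S b -> forall x, exists P : D, x = P *: e b.
Proof.
move=> Sb; apply: (grading_ind (gm_grading M)) => [|x y [P ->] [Q ->]|i x].
- by exists 0; rewrite scale0r.
- by exists (P + Q); rewrite scalerDl.
- move=> /(w_span W) [c ->]; have [Si|Si] := boolP (S i); last first.
    by exists 0; rewrite w_out // scaler0 scale0r.
  have [P [phi [hP phi0]]] := w_conn W Sb Si.
  exists ((c / phi.[lam + b%:~R])%:A * P).
  by rewrite -(scalerA _ P) (w_act W hP Sb) scalarA divfK // addrC subrK.
Qed.

(** A nonzero homogeneous element of a graded submodule is a multiple of some e i, from
    which w_conn reaches all the others. *)
Lemma w_simple (T : M -> Prop) : is_gsub T ->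
  (forall x, T x -> x = 0) \/ (forall x, T x).
Proof.
move=> [T0 TZ Th]; case: (pselect (exists i, S i /\ T (e i))) => [[i [Si Ti]]|h].
  right=> x; have [P ->] := w_gen Si x.
  by rewrite -[_ *: _]addr0; exact: TZ.
left=> x /Th [s hs ->]; rewrite big_seq big1 // => p /hs [pd Tp].
have [c pE] := w_span W pd; have [Si|Si] := boolP (S p.1); last first.
  by rewrite pE w_out // scaler0.
have [c0|c0] := eqVneq c 0; first by rewrite pE c0 scale0r scale0r.
case: h; exists p.1; split=> //.
have -> : e p.1 = (c^-1)%:A *: p.2 + 0.
  by rewrite pE scalarA mulVf // addr0 scale1r scale1r.
exact: TZ.
Qed.
End WeightTheory.

Lemma gsub_of_hcomp (X : gmod D) (T : X -> Prop) : T 0 ->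
  (forall (a : D) x y, T x -> T y -> T (a *: x + y)) ->
  (forall x i, T x -> T (hcomp (gm_grading X) x i)) -> is_gsub T.
Proof.
move=> T0 TZ Th; split=> // x Tx.
have [s [_ _ xE]] := hcomp_sum (gm_grading X) x.
exists [seq (i, hcomp (gm_grading X) x i) | i <- s]; last by rewrite big_map.
move=> _ /mapP [i _ ->] /=; split; [exact: hcomp_deg | exact: Th].
Qed.

Lemma gsub_hcomp (X : gmod D) (T : X -> Prop) x i : is_gsub T -> T x ->
  T (hcomp (gm_grading X) x i).
Proof. by move=> hT; exact: (@gs_hcomp _ _ _ (Gsub hT)). Qed.

(** * Extensions of weight modules *)

Section WeightExtensions.
Variables (M N : gmod D) (lam lam' : k) (S S' : pred int) (e : int -> M) (e' : int -> N).
Hypotheses (WM : weighted lam S e) (WN : weighted lam' S' e').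

(** The composition series is 0 < N < X, both factors being simple. *)
Lemma weighted_finite_length (X : gext M N) : finite_length (ext_mid X).
Proof.
have inj_eq0 n : ext_inj X n = 0 -> n = 0.
  by rewrite -(linear0 (ext_inj X)) => /ext_inj_injective.
pose F (i : nat) (x : ext_mid X) : Prop :=
  match i with 0 => x = 0 | 1 => exists n, x = ext_inj X n | _ => True end.
have F0 : is_gsub (F 0%N).
  apply: gsub_of_hcomp => // [a x y -> ->|x i ->]; first by rewrite scaler0 addr0.
  exact: hcomp0.
have F1 : is_gsub (F 1%N).
  apply: gsub_of_hcomp => [|a x y [n ->] [n' ->]|x i [n ->]].
  - by exists 0; rewrite linear0.
  - by exists (a *: n + n'); rewrite linearP.
  - by eexists; apply: hcomp_homog0; exact: ext_inj_homog.
exists 2, F; split=> //.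
  by case=> [//|[//|i]]; split=> // x _; have [s hs ->] := grading_sum (gm_grading _) x; exists s => // p /hs.
case=> [_|[_|//]]; split.
- by move=> x ->; exists 0; rewrite linear0.
- have [i Si] := w_inh WN => h; move/(w_supp WN): Si; apply.
  by apply/inj_eq0/h; exists (e' i).
- move=> T hT _ hT1; have [T0 TZ _] := hT.
  have [|hn|hn] := @w_simple _ _ _ _ WN (fun n => T (ext_inj X n)).
  + apply: gsub_of_hcomp => [|a n n' hn hn'|n i hn]; rewrite ?linear0 ?linearP //.
      exact: TZ.
    by rewrite -hcomp_homog0; [exact: gsub_hcomp | exact: ext_inj_homog].
  + by left=> x Tx; case: (hT1 _ Tx) => n xn; rewrite xn (hn n) ?linear0 // -xn.
  + by right=> x [n ->].
- by [].
- have [i Si] := w_inh WM => h; move/(w_supp WM): Si; apply.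
  have [x <-] := ext_proj_surjective X (e i).
  by apply/ext_exact/h.
- move=> T hT hT1 _; have [T0 TZ _] := hT.
  have [|hm|hm] := @w_simple _ _ _ _ WM (fun m => exists2 x, T x & ext_proj X x = m).
  + apply: gsub_of_hcomp => [|a m m' [x Tx <-] [x' Tx' <-]|m i [x Tx <-]].
    * by exists 0; rewrite ?linear0.
    * by exists (a *: x + x'); rewrite ?linearP //; exact: TZ.
    * exists (hcomp (gm_grading _) x i); first exact: gsub_hcomp.
      by rewrite hcomp_homog0 //; exact: ext_proj_homog.
  + by left=> x Tx; apply/ext_exact; apply: hm; exists x.
  + right=> x _; have [y Ty xy] := hm (ext_proj X x).
    rewrite -(subrK y x) -[x - y]scale1r; apply: TZ => //; apply: hT1.
    by apply/ext_exact; rewrite linearB /= xy subrr.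
Qed.

(** (E - degree) is D-linear, equal to lam on M and to lam' on N, so it splits every
    extension when lam <> lam': the lift below is a projection on its lam-eigenspace. *)
Lemma weighted_Ext1_zero_eigen : lam != lam' -> Ext1_zero M N.
Proof.
move=> ll X; have [b Sb] := w_inh WM.
have [x xb xe] := ext_lift_homog X (w_deg WM b).
have d0 : lam - lam' != 0 by rewrite subr_eq0.
pose Q : D := Euler k Gam - (lam' + b%:~R)%:A.
have hQ : symbol Q 0 _ := symbol_euler (lam' + b%:~R).
pose y := (((lam - lam')^-1)%:A : D) *: (Q *: x).
apply: (@ext_split_of_lift _ _ M N b (e b) (w_deg WM b) (w_gen WM Sb) X y).
- rewrite /y scalerA -[b]add0r; apply: gm_degZ => //.
  by rewrite -[0]addr0; apply: gr_degM; [exact: gr_degA | exact: symbol_deg hQ].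
- rewrite /y !ext_projZ xe (w_act WM hQ Sb) addr0 scalarA.
  rewrite !hornerE opprD addrACA subrr addr0 mulVf //.
  by rewrite !scale1r.
- move=> j P Pj Pe; have [phi hP] := deg_symbol Pj.
  have [n nj Pn] : exists2 n, gm_deg (j + b) n & P *: x = ext_inj X n.
    by apply: ext_ker_homog; [exact: gm_degZ | rewrite ext_projZ xe].
  have hQ' := symbol_euler (lam' + (j + b)%:~R).
  have PQ : P * Q = (Euler k Gam - (lam' + (j + b)%:~R)%:A) * P.
    apply: symbol_inj (symbolM hP hQ) _.
    apply: symbol_eq (symbolM hQ' hP) _ _; first by rewrite addr0 add0r.
    rewrite comp_poly_shift0 mulrC rmorphB /= comp_polyX comp_polyC.
    by congr (_ * _); rewrite intrD !polyCD; ring.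
  rewrite /y scalarCA scalerA PQ -scalerA Pn -ext_injZ (w_act_deg WN nj hQ').
  by rewrite !hornerE subrr scale0r scale0r linear0 scaler0.
Qed.

(** The class of an extension of e b is the functional Delta on symbols, up to a
    scalar; the condition on products says that t ^ j phi(E) |-> Delta(phi) e'_(b + j)
    is left linear on the annihilator of e b. *)
Lemma weighted_Ext1_isom (b : int) (Delta : {poly k} -> k) : S b ->
  {morph Delta : p q / p + q} ->
  (forall i j P Q phi psi, symbol P i phi -> symbol Q j psi -> Q *: e b = 0 ->
     ((Delta ((phi \Po ('X + j%:~R%:P)) * psi))%:A : D) *: e' (b + j + i) =
       ((Delta psi)%:A : D) *: (P *: e' (b + j))) ->
  (exists j P phi, [/\ symbol P j phi, P *: e b = 0,
     forall n : N, gm_deg b n -> P *: n = 0, Delta phi != 0 & S' (b + j)]) ->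
  (forall X : gext M N, exists c (x : ext_mid X), [/\ gm_deg b x, ext_proj X x = e b
     & forall j P phi, symbol P j phi -> P *: e b = 0 ->
         P *: x = ext_inj X (((c * Delta phi)%:A : D) *: e' (b + j))]) ->
  Ext1_isom_k M N.
Proof.
move=> Sb DD Dmul [j0 [P0 [phi0 [hP0 P0e P0N D0 S0]]]] surj.
have [|h hD hh] := @graded_additive_extension D N _ (gr_grading D)
    (fun j P => ((Delta (symb j (diff_val P)))%:A : D) *: e' (b + j)).
  move=> j P Q /deg_symbol [phi hP] /deg_symbol [psi hQ].
  by rewrite (symbolD hP hQ) hP hQ !symbK // DD scalerDl scalerDl.
have hE P j phi : symbol P j phi -> h P = ((Delta phi)%:A : D) *: e' (b + j).
  by move=> hP; rewrite (hh j) ?hP ?symbK //; exact: symbol_deg hP.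
apply: (@Ext1_isom_k_cyclic _ _ M N b (e b) (w_deg WM b) (w_gen WM Sb) h hD).
- move=> j P /deg_symbol [phi hP]; rewrite (hE _ _ _ hP) addrC.
  by have := gm_degZ (gr_degA D (Delta phi)) (w_deg WN (b + j)); rewrite add0r.
- have h0 : h 0 = 0 by apply: (@addrI _ (h 0)); rewrite -hD !addr0.
  move=> P Q Qe; move: Q Qe P.
  apply: (@ann_graded_ind _ _ M b (e b) (fun Q => forall P, h (P * Q) = P *: h Q) (w_deg WM b)).
  + by move=> P; rewrite mulr0 h0 scaler0.
  + by move=> Q Q' hQ hQ' P; rewrite mulrDr !hD scalerDr hQ hQ'.
  move=> j Q /deg_symbol [psi hQ] Qe; apply: (grading_ind (gr_grading D)).
  + by rewrite mul0r h0 scale0r.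
  + by move=> P P' hP hP'; rewrite mulrDl hD scalerDl hP hP'.
  move=> i P /deg_symbol [phi hP].
  rewrite (hE _ _ _ (symbolM hP hQ)) (hE _ _ _ hQ) scalarCA.
  by rewrite (addrC i) addrA (Dmul _ _ _ _ _ _ hP hQ Qe).
- exists P0; split=> //; rewrite (hE _ _ _ hP0) => /scalarI [/eqP|].
    by rewrite (negbTE D0).
  by move/(w_supp WN): S0.
- move=> X; have [c [x [xb xe hx]]] := surj X; exists c, x; split=> // j P Pj Pe.
  have [phi hP] := deg_symbol Pj.
  by rewrite (hx _ _ _ hP Pe) (hE _ _ _ hP) scalarA.
Qed.
End WeightExtensions.

(** An extension of a weight module by itself splits if some operator P leaves the set
    of weights at e b and comes back through Q: then Q P = rho(E) vanishes on a lift x of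
    e b, and as rho has a simple root there, x is an eigenvector of E. *)
Lemma weighted_self_Ext1_zero (M : gmod D) lam S (e : int -> M) (b l : int) P Q phi psi :
  weighted lam S e -> S b -> ~~ S (b + l) ->
  symbol P l phi -> symbol Q (- l) psi ->
  ((psi \Po ('X + l%:~R%:P)) * phi).[lam + b%:~R] = 0 ->
  ((psi \Po ('X + l%:~R%:P)) * phi)^`().[lam + b%:~R] != 0 ->
  (forall j R, gr_deg j R -> S (b + j) -> R *: e b = 0 ->
     exists R', R = R' * (Euler k Gam - (lam + b%:~R)%:A)) ->
  Ext1_zero M M.
Proof.
set rho := _ * _ => W Sb Sl hP hQ rho0 rho1 hfac X.
have [x xb xe] := ext_lift_homog X (w_deg W b).
have X0 i z : ~~ S i -> gm_deg i z -> z = 0 :> ext_mid X.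
  move=> Si zi; have [n ni ->] : exists2 n, gm_deg i n & z = ext_inj X n.
    by apply: ext_ker_homog => //; apply: (w_zero W Si); exact: ext_proj_homog.
  by rewrite (w_zero W Si ni) linear0.
pose E : D := Euler k Gam - (lam + b%:~R)%:A.
have hE : symbol E 0 _ := symbol_euler (lam + b%:~R).
have [n nb En] : exists2 n, gm_deg b n & E *: x = ext_inj X n.
  apply: ext_ker_homog; first by rewrite -[b]add0r; apply: gm_degZ => //; exact: symbol_deg hE.
  rewrite ext_projZ xe (w_act W hE Sb) addr0.
  by rewrite !hornerE subrr scale0r scale0r.
have Ex : E *: x = 0.
  have [q [qE q1]] := poly_factor rho0; have [Rq hRq] := symbol_ex0 q.
  have QP : Q * P = Rq * E.
    apply: (@symbol_inj _ _ 0 rho).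
      by apply: symbol_eq (symbolM hQ hP) _ _; rewrite ?addNr.
    apply: symbol_eq (symbolM hRq hE) (addr0 0) _; by rewrite comp_poly_shift0 -qE.
  have Px : P *: x = 0 by apply: (X0 (b + l)) => //; rewrite addrC; apply: gm_degZ => //; exact: symbol_deg hP.
  have : Rq *: (E *: x) = 0 by rewrite scalerA -QP -scalerA Px scaler0.
  rewrite En -ext_injZ (w_act_deg W nb hRq) -(linear0 (ext_inj X)).
  move=> /ext_inj_injective /scalarI []; last by move=> ->; rewrite linear0.
  by rewrite -q1 => /eqP; rewrite (negbTE rho1).
apply: (@ext_split_of_lift _ _ M M b (e b) (w_deg W b) (w_gen W Sb) X x) => //.
move=> j R Rj Re; have [Sj|Sj] := boolP (S (b + j)); last first.
  by apply: (X0 (b + j)) => //; rewrite addrC; exact: gm_degZ.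
by have [R' ->] := hfac j R Rj Sj Re; rewrite -scalerA Ex scaler0.
Qed.

(** When M and N have complementary weights, an extension is governed by the operators
    from b to a single weight i1 of N: any two of those, V and W, satisfy
    W v1(E) = V w1(E), which fixes the ratio of their values on a lift of e b, and every
    other operator can be continued to i1 inside the connected module N. *)
Lemma weighted_complementary_Ext1 (M N : gmod D) lam (S S' : pred int)
    (e : int -> M) (e' : int -> N) (b i1 : int) (Delta : {poly k} -> k) :
  weighted lam S e -> weighted lam S' e' -> S b -> ~~ S' b -> S' i1 -> ~~ S i1 ->
  {morph Delta : p q / p + q} ->
  (forall i j P Q phi psi, symbol P i phi -> symbol Q j psi -> Q *: e b = 0 ->
     ((Delta ((phi \Po ('X + j%:~R%:P)) * psi))%:A : D) *: e' (b + j + i) =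
       ((Delta psi)%:A : D) *: (P *: e' (b + j))) ->
  (forall V W v w, symbol V (i1 - b) v -> symbol W (i1 - b) w -> exists v1 w1,
     [/\ w * v1 = v * w1, v1.[lam + b%:~R] = Delta v & w1.[lam + b%:~R] = Delta w]) ->
  (exists P phi, symbol P (i1 - b) phi /\ Delta phi != 0) ->
  Ext1_isom_k M N.
Proof.
move=> WM WN Sb S'b S'i1 Si1 DD Dmul exch [P1 [phi1 [hP1 D1]]].
have kill P phi : symbol P (i1 - b) phi -> P *: e b = 0.
  by move=> hP; rewrite (w_act WM hP Sb) (addrC b) subrK (w_out WM) ?scaler0.
apply: (weighted_Ext1_isom WM WN Sb DD Dmul).
  exists (i1 - b), P1, phi1; split=> //; first exact: kill hP1.
  - by move=> n /(w_zero WN S'b) ->; rewrite scaler0.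
  - by rewrite addrC subrK.
move=> X; have [x xb xe] := ext_lift_homog X (w_deg WM b).
have ker i z : gm_deg i z -> ext_proj X z = 0 -> exists a : k, z = ext_inj X ((a%:A : D) *: e' i).
  by move=> zi /(ext_ker_homog zi) [n /(w_span WN) [a ->] ->]; exists a.
pose E : D := Euler k Gam - (lam + b%:~R)%:A.
have hE : symbol E 0 _ := symbol_euler (lam + b%:~R).
have Ex : E *: x = 0.
  have [||a ->] := ker b (E *: x).
  - by rewrite -[b]add0r; apply: gm_degZ => //; exact: symbol_deg hE.
  - rewrite ext_projZ xe (w_act WM hE Sb) addr0.
    by rewrite !hornerE subrr scale0r scale0r.
  - by rewrite (w_out WN S'b) scaler0 linear0.
have kerP j P phi : symbol P j phi -> P *: e b = 0 ->
    exists a : k, P *: x = ext_inj X ((a%:A : D) *: e' (b + j)).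
  move=> hP Pe; apply: ker; last by rewrite ext_projZ xe.
  by rewrite addrC; apply: gm_degZ => //; exact: symbol_deg hP.
have [a1 P1x] := kerP _ _ _ hP1 (kill _ _ hP1).
exists (a1 / Delta phi1), x; split=> // j P phi hP Pe.
have [a Px] := kerP _ _ _ hP Pe.
have [S'j|S'j] := boolP (S' (b + j)); last first.
  by rewrite Px (w_out WN S'j) !scaler0.
have [R [r [hR r0]]] := w_conn WN S'j S'i1.
have hRP := symbolM hR hP; set s := _ * phi in hRP.
have {}hRP : symbol (R * P) (i1 - b) s.
  by apply: symbol_eq hRP _ (erefl s); rewrite opprD addrA subrK.
have [v1 [w1 [vw v1b w1b]]] := exch _ _ _ _ hP1 hRP.
have [V1 hV1] := symbol_ex0 v1; have [W1 hW1] := symbol_ex0 w1.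
have VW : (R * P) * V1 = P1 * W1.
  apply: symbol_inj (symbolM hRP hV1) _; apply: symbol_eq (symbolM hP1 hW1) _ _ => //.
  by rewrite !comp_poly_shift0.
have i1E : b + j + (i1 - (b + j)) = i1 by rewrite addrC subrK.
have Re : R *: e' (b + j) <> 0.
  rewrite (w_act WN hR S'j) i1E => /scalarI [/eqP|]; first by rewrite (negbTE r0).
  exact/(w_supp WN).
have := Dmul _ _ _ _ _ _ hR hP Pe; rewrite i1E -/s => sE.
have aE : Delta phi1 * a = a1 * Delta phi.
  move: (congr1 (fun Z : D => Z *: x) VW).
  rewrite -!scalerA (euler_eigen Ex hV1) (euler_eigen Ex hW1) !scalarCA P1x Px.
  rewrite v1b w1b -!ext_injZ => /ext_inj_injective.
  rewrite (addrC b (i1 - b)) subrK (scalarCA a1) sE (scalarCA a) !scalarA => /eqP.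
  rewrite -subr_eq0 -scalerBl -scalerBl => /eqP /scalarI [/eqP|//].
  by rewrite subr_eq0 => /eqP.
by rewrite Px; congr (ext_inj X (_%:A *: _)); apply: (mulfI D1); rewrite aE; field.
Qed.

(** No integer is a weight, so all operators with symbol divisible by E - lam factor
    through E - lam, and the class of an extension is the nilpotent part of E on a lift
    of e 0. *)
Lemma weighted_generic_Ext1 (M : gmod D) lam (e : int -> M) :
  weighted lam predT e -> (forall m : int, lam != m%:~R) -> Ext1_isom_k M M.
Proof.
move=> W lamZ; pose Delta (p : {poly k}) := p^`().[lam].
have kill P j phi : symbol P j phi -> P *: e 0 = 0 -> phi.[lam] = 0.
  by move=> hP /(w_kill W hP isT isT); rewrite addr0.
have hE := symbol_euler lam.
apply: (weighted_Ext1_isom W W (b := 0) (Delta := Delta) (S := predT) isT) => //.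
- by move=> p q; rewrite /Delta derivD hornerD.
- move=> i j P Q phi psi hP hQ /(kill _ _ _ hQ) psi0.
  rewrite (w_act W hP isT) scalarA /Delta derivM hornerD !hornerM psi0 mulr0 add0r.
  by rewrite horner_comp !hornerE mulrC.
- exists 0, (Euler k Gam - lam%:A), ('X - lam%:P); split=> //.
  + by rewrite (w_act W hE isT) addr0 !hornerE subrr scale0r scale0r.
  + move=> n n0; rewrite (w_act_deg W n0 hE) addr0.
    by rewrite !hornerE subrr scale0r scale0r.
  + by rewrite /Delta !derivE !hornerE oner_eq0.
move=> X; have [x x0 xe] := ext_lift_homog X (w_deg W 0).
have [n n0 En] : exists2 n, gm_deg 0 n & (Euler k Gam - lam%:A : D) *: x = ext_inj X n.
  apply: ext_ker_homog; first by rewrite -[0]addr0; apply: gm_degZ => //; exact: symbol_deg hE.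
  by rewrite ext_projZ xe (w_act W hE isT) addr0 !hornerE subrr scale0r scale0r.
have [c nE] := w_span W n0; exists c, x; split=> // j P phi hP /(kill _ _ _ hP) phi0.
have [|Q [q [hQ -> q1]]] := euler_factor hP phi0.
  by move=> m /eqP; rewrite (negbTE (lamZ m)).
rewrite -scalerA En -ext_injZ nE scalarCA (w_act W hQ isT) scalarA addr0.
by rewrite /Delta q1.
Qed.
End Symbols.

(** * The simple modules as weight modules *)

Section SimpleModules.
Variable k : fieldType.
Hypothesis k_char0 : injective (fun n : int => n%:~R : k).
Variable Gam : pred nat.
Hypothesis hGam : numerical_semigroup Gam.
Notation D := (gDiff k Gam).

Lemma memZ_conductor : exists c : nat, forall n : int, c%:Z <= n -> memZ Gam n.
Proof.
have [_ _ [c hc]] := hGam; exists c => -[n|n] //= h; apply: hc; lia.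
Qed.

Lemma memZ0 : memZ Gam 0. Proof. by have [] := hGam. Qed.

Lemma symbol_minimal j : exists P chi, [/\ symbol (Gam := Gam) P j chi,
    forall a, chi.[a] = 0 -> exists m, [/\ a = m%:~R :> k, memZ Gam m & ~~ memZ Gam (m + j)]
  & forall m, memZ Gam m -> ~~ memZ Gam (m + j) ->
      chi.[m%:~R] = 0 /\ chi^`().[m%:~R] != 0].
Proof.
have [_ _ [c hc]] := hGam.
have [chi [cadm croot cder]] := minimal_admissible k_char0 Gam j hc.
have [P hP] := symbol_ex cadm; exists P, chi; split=> // m Gm Gj.
by split; [exact: cadm | exact: cder].
Qed.

(** The degree j part of D can send t ^ a to a nonzero multiple of t ^ (a + j) as soon as
    this does not leave k[Gam]: at weight a, minimality of chi forbids nothing else. *)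
Lemma symbol_transition (a : k) j :
  (forall m, a = m%:~R -> memZ Gam m -> memZ Gam (m + j)) ->
  exists P phi, symbol (Gam := Gam) P j phi /\ phi.[a] != 0.
Proof.
move=> h; have [P [chi [hP croot _]]] := symbol_minimal j; exists P, chi; split=> //.
by apply/eqP => /croot [m [am Gm]]; rewrite (h m am Gm).
Qed.

Lemma lsupp_monom S i : lsupp S (monom k i) = memZ S i.
Proof.
apply/lsuppP/idP => [/(_ i)|Si n]; rewrite /= /monom_fun.
  by rewrite eqxx oner_eq0; apply.
by case: (n =P i) => [->//|_]; rewrite eqxx.
Qed.

Lemma weighted_M_zero : weighted (M := M_zero k Gam) 0 (memZ Gam)
  (fun i => insubd (0 : semialg k Gam) (monom k i)).
Proof.
have eE i n : val (insubd (0 : semialg k Gam) (monom k i)) n = (memZ Gam i && (n == i))%:R :> k.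
  by rewrite val_insubd lsupp_monom; case: ifP.
split.
- move=> i n /negbTE ni; rewrite eE ni andbF; exact: mulr0n.
- move=> i f hf; exists (val f i); apply: val_inj; apply/laurentP => n.
  rewrite [RHS](_ : _ = val f i * val (insubd (0 : semialg k Gam) (monom k i)) n); last first.
    by [].
  rewrite eE; case: (n =P i) => [->|/eqP ni]; last by rewrite andbF mulr0; exact: hf.
  rewrite andbT; case: (boolP (memZ Gam i)) => Gi; first by rewrite mulr1.
  rewrite mulr0; apply/eqP/contraT => fi.
  by move/lsuppP: (valP f) Gi => /(_ _ fi) ->.
- move=> i; split=> [Gi /(congr1 (fun f : semialg k Gam => val f i : k))|h].
    by rewrite eE Gi eqxx => /eqP; rewrite oner_eq0.
  apply: contrapT => Gi; apply: h; apply: val_inj; apply/laurentP => n.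
  by rewrite eE; case: (memZ Gam i) Gi.
- move=> P j phi i hP Gi; apply: val_inj; apply/laurentP => n.
  rewrite [LHS](_ : _ = hop j phi (val (insubd (0 : semialg k Gam) (monom k i))) n); last first.
    by rewrite -hP.
  rewrite [RHS](_ : _ = phi.[0 + i%:~R] * val (insubd (0 : semialg k Gam) (monom k (i + j))) n); last first.
    by [].
  rewrite hopE !eE Gi subr_eq add0r /=; case: eqP => [->|_]; last by rewrite andbF !mulr0.
  rewrite addrK andbT mulr1; case: (boolP (memZ Gam (i + j))) => Gj; first by rewrite mulr1.
  by rewrite mulr0; exact: (symbol_adm hP).
- move=> i i' Gi Gi'; apply: symbol_transition => m; rewrite add0r => /k_char0 <- _.
  by rewrite addrC subrK.
- by exists 0; exact: memZ0.
Qed.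

(** A quotient of a module of operators D(k[S0], k[Gam]) in which t ^ j phi(E) is
    determined by phi(lam + b): the generator t ^ (lam + b) is placed in degree b. *)
Lemma weighted_of_operators (M : gmod D) (S0 : pred nat) (pi : dhom k S0 Gam -> M)
    (lam : k) (b : int) (S : pred int) :
  (forall P Q, pi (P + Q) = pi P + pi Q) ->
  (forall (P : D) Q, pi (dhom_lact P Q) = P *: pi Q) ->
  (forall j (Q : dhom k S0 Gam), homT j (dhom_val Q) -> gm_deg (b + j) (pi Q)) ->
  (forall j x, gm_deg (b + j) x -> exists2 Q : dhom k S0 Gam, homT j (dhom_val Q) & x = pi Q) ->
  (forall j (Q : dhom k S0 Gam) phi, dhom_val Q = hop j phi -> phi.[lam + b%:~R] = 0 -> pi Q = 0) ->
  (forall j, exists (Q : dhom k S0 Gam) phi, dhom_val Q = hop j phi /\ phi.[lam + b%:~R] != 0) ->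
  (forall j (Q : dhom k S0 Gam) phi, dhom_val Q = hop j phi -> phi.[lam + b%:~R] != 0 ->
     (S (b + j) <-> pi Q <> 0)) ->
  (forall i i' m, S i -> S i' -> lam + i%:~R = m%:~R -> memZ Gam m ->
     memZ Gam (m + (i' - i))) ->
  (exists i, S i) ->
  exists e, weighted (M := M) lam S e.
Proof.
move=> piD piM piH pisurj pi0 tr piS conn inh.
have piZ (c : k) Q : pi (dhom_lact (c%:A : D) Q) = (c%:A : D) *: pi Q by exact: piM.
have dval (c : k) (Q : dhom k S0 Gam) j phi : dhom_val Q = hop j phi ->
    dhom_val (dhom_lact (c%:A : D) Q) = hop j (c%:P * phi).
  move=> QE; have cE : diff_val (c%:A : D) = hop 0 c%:P := scalar_hop c.
  have -> : dhom_val (dhom_lact (c%:A : D) Q) = diff_val (c%:A : D) * dhom_val Q by [].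
  by rewrite cE QE hopM add0r comp_polyC.
have val1 j (Q Q' : dhom k S0 Gam) phi phi' : dhom_val Q = hop j phi -> dhom_val Q' = hop j phi' ->
    phi.[lam + b%:~R] != 0 -> pi Q' = ((phi'.[lam + b%:~R] / phi.[lam + b%:~R])%:A : D) *: pi Q.
  move=> QE QE' p0; apply/eqP; rewrite -subr_eq0 -scaleNr -scaleNr -piZ -piD; apply/eqP.
  apply: (pi0 j _ (phi' + (- (phi'.[lam + b%:~R] / phi.[lam + b%:~R]))%:P * phi)).
    rewrite -hopD -QE'; congr (_ + _); exact: dval.
  by rewrite hornerD hornerM hornerC mulNr divfK // subrr.
have [f fP] : exists f : int -> dhom k S0 Gam * {poly k}, forall j,
    dhom_val (f j).1 = hop j (f j).2 /\ (f j).2.[lam + b%:~R] != 0.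
  pose g j := cid (tr j).
  exists (fun j => (projT1 (g j), projT1 (cid (projT2 (g j))))) => j /=.
  exact: projT2 (cid (projT2 (g j))).
pose c j := (f j).2.[lam + b%:~R].
pose e i : M := (((c (i - b))^-1)%:A : D) *: pi (f (i - b)).1.
have eE j Q phi : dhom_val Q = hop j phi -> pi Q = ((phi.[lam + b%:~R])%:A : D) *: e (b + j).
  move=> QE; rewrite /e (addrC b) addrK scalarA; have [fE f0] := fP j; exact: (val1 j _ _ _ _ fE QE f0).
have e0 i : e i = 0 <-> pi (f (i - b)).1 = 0.
  rewrite /e; split=> [/scalarI [/eqP|//]|->]; last by rewrite scaler0.
  by rewrite invr_eq0 (negbTE (fP _).2).
have S_e i : S i <-> e i <> 0.
  rewrite e0; have [fE f0] := fP (i - b); have := piS _ _ _ fE f0.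
  by rewrite addrC subrK.
exists e; split=> //.
- move=> i; rewrite /e -[i in gm_deg i _]add0r; apply: gm_degZ; first exact: gr_degA.
  rewrite -[i in gm_deg i _](subrK b) addrC; apply: piH.
  by rewrite (fP _).1; exact: hop_hom.
- move=> i x; rewrite -[i in gm_deg i _](subrK b) addrC => /pisurj [Q /homT_hop [phi QE] ->].
  exists phi.[lam + b%:~R]; rewrite (eE _ _ _ QE); congr (_ *: e _).
  by rewrite addrC subrK.
- move=> P j phi i hP _; rewrite {1}/e scalarCA -piM.
  have [fE f0] := fP (i - b).
  have QE : dhom_val (dhom_lact P (f (i - b)).1) = hop (j + (i - b))
      ((phi \Po ('X + (i - b)%:~R%:P)) * (f (i - b)).2).
    by rewrite -hopM -hP -fE.
  rewrite (eE _ _ _ QE) scalarA; congr (_%:A *: _).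
    rewrite hornerM horner_comp hornerD hornerX hornerC mulrCA mulVf // mulr1.
    by congr (_.[_]); rewrite intrB; ring.
  by congr e; ring.
- move=> i i' Si Si'; apply: symbol_transition => m; exact: conn.
Qed.

Lemma weighted_M_alpha (a : k) : (forall m : int, a != m%:~R) ->
  exists e, weighted (M := M_alpha Gam a) a predT e.
Proof.
move=> aZ; pose S := lideal (Euler_deg Gam a).
pose pi (Q : dhom k Gam Gam) : M_alpha Gam a := gquot_pi S (DiffOp (valP Q) : D).
have hE := symbol_euler Gam a.
apply: (@weighted_of_operators _ Gam pi a 0).
- by move=> P Q; rewrite -gquot_piD; congr gquot_pi; exact: val_inj.
- move=> P Q; rewrite /pi; apply: esym; apply: etrans (gquot_scale_pi _ _ _) _.
  by congr gquot_pi; exact: val_inj.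
- by move=> j Q Qj; rewrite add0r; exists (DiffOp (valP Q) : D).
- move=> j x; rewrite add0r => -[P Pj ->]; exists (Dhom (valP P)) => //.
  by congr gquot_pi; exact: val_inj.
- move=> j Q phi QE; rewrite addr0 => p0.
  have hQ : symbol (DiffOp (valP Q) : D) j phi by [].
  have [|P [_ [_ PE _]]] := euler_factor hQ p0.
    by move=> m /eqP; rewrite (negbTE (aZ m)).
  by rewrite /pi -(gquot_pi0 S); apply/gquot_piP; rewrite subr0; exists P.
- move=> j; have [|P [phi [hP p0]]] := @symbol_transition a j.
    by move=> m /eqP; rewrite (negbTE (aZ m)).
  by exists (Dhom (valP P)), phi; rewrite addr0.
- move=> j Q phi QE; rewrite addr0 => p0; split=> // _.
  rewrite /pi -(gquot_pi0 S) => /gquot_piP; rewrite subr0 => -[P PE].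
  have hQ : symbol (DiffOp (valP Q) : D) j phi by [].
  have QP : (DiffOp (valP Q) : D) = P * (Euler k Gam - a%:A) by [].
  have [psi hpsi] := deg_symbol (hcomp_deg (gr_grading D) P j).
  have /(_ (symbol_deg hQ)) QP' : gr_deg j (DiffOp (valP Q) : D) ->
      (DiffOp (valP Q) : D) = hcomp (gr_grading D) P j * (Euler k Gam - a%:A).
    move=> Qj; have := @hcomp_scale _ _ (greg D) 0 (Euler k Gam - a%:A) P j (Euler_deg Gam a).
    rewrite subr0; apply: etrans; rewrite -[_ *: _]/(P * (Euler k Gam - a%:A) : greg D) -QP.
    by rewrite (hcomp_id _ _ (Qj : gm_deg (g := greg D) j _)) eqxx.
  have := symbM k_char0 hpsi hE; rewrite -QP' addr0 hQ symbK // => pE.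
  by case/eqP: p0; rewrite pE hornerM !hornerE subrr mulr0.
- move=> i i' m _ _ /eqP; rewrite eq_sym -subr_eq -intrB => /eqP am.
  by have := aZ (m - i); rewrite am eqxx.
- by exists 0.
Qed.

Local Notation U := (gdhom k predT Gam).

(** The class of 1 in V(0) plays the part of t ^ (-1) in k[t, t^-1] / k[t]. *)
Definition V0_gen : V0 k := gquot_pi (lideal (tA1_deg k)) (1 : gDiff k predT).

(** D(B, A) (x) V(0) consists of the pure tensors Q (x) V0_gen, since V0_gen generates
    V(0); Q (x) V0_gen stands for Q(t ^ (-1)) in k[t, t^-1] / A. *)
Definition infty_tens (Q : dhom k predT Gam) : M_infty k Gam := tens1 (Q : U) V0_gen.

Lemma infty_tens_act (P : D) Q : infty_tens (dhom_lact P Q) = P *: infty_tens Q.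
Proof. exact: esym (tens_scaleE P [:: (Q : U, V0_gen)]). Qed.

Lemma V0_gen_kill : (tA1 k : gDiff k predT) *: V0_gen = 0.
Proof.
apply: etrans (gquot_scale_pi _ _ _) _; apply: etrans _ (gquot_pi0 _); apply/gquot_piP.
by rewrite subr0; exists 1; rewrite mul1r; exact: mulr1.
Qed.

(** t kills the generator of V(0), so operators in D(B, A) t are killed; an operator
    t ^ j phi(E) is of that form unless it sends t ^ (-1) to a monomial outside A. *)
Lemma infty_tens_eq0 j (Q : dhom k predT Gam) phi : dhom_val Q = hop j phi ->
  phi.[(- 1)%:~R] = 0 \/ memZ Gam (j - 1) -> infty_tens Q = 0.
Proof.
move=> QE h; have hQ : is_dhom predT Gam (hop j phi) by rewrite -QE; exact: (valP Q).
have hR : is_dhom predT Gam (hop (j - 1) (phi \Po ('X + (- 1)%:~R%:P))).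
  apply/is_dhom_hop => m Sm Gm; rewrite horner_comp !hornerE -intrD.
  case: m Sm Gm => [[|m]|//] _ Gm.
    by rewrite (add0r (j - 1 : int)) in Gm; case: h => [|Gj]; [rewrite add0r | rewrite Gj in Gm].
  move/is_dhom_hop: hQ; apply; first by rewrite intS addrAC subrr add0r.
  by apply: contra Gm; congr memZ; ring.
have -> : Q = dhom_ract (Dhom hR) (tA1 k).
  apply: val_inj; rewrite /= QE lshift_hop hopM subrK mulr1.
  rewrite -comp_polyA comp_polyD comp_polyX comp_polyC -addrA -polyCD -intrD.
  by rewrite subrr comp_poly_shift0.
have [_ _ bal] := tens1_balanced U (V0 k).
by rewrite /infty_tens (bal (Dhom hR : U)) V0_gen_kill tens1_0r.
Qed.

(** The pairing R (x) P |-> coefficient of t ^ i in R P (t ^ (-1)), for i outside Gam: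
    it detects the generator in degree i. *)
Lemma infty_tens_neq0 j (Q : dhom k predT Gam) phi : dhom_val Q = hop j phi ->
  phi.[(- 1)%:~R] != 0 -> ~~ memZ Gam (j - 1) -> infty_tens Q <> 0.
Proof.
move=> QE p0 Gj.
pose f (R : U) (w : V0 k) : k :=
  dhom_val R (diff_val (repr (w : gquot_type _)) (monom k (- 1))) (j - 1).
have fE (R : U) P : f R (gquot_pi _ P) = dhom_val R (diff_val P (monom k (- 1))) (j - 1).
  have [L LE] : lideal (tA1_deg k) (repr (gquot_pi (lideal (tA1_deg k)) P) - P).
    by apply/gquot_piP; rewrite /gquot_pi reprK.
  apply/eqP; rewrite -subr_eq0 -lcoefB -linearB -lopB.
  have -> : diff_val (repr (gquot_pi (lideal (tA1_deg k)) P)) - diff_val P = diff_val (L * tA1 k).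
    by rewrite -LE.
  have : lsupp Gam (dhom_val R (diff_val L (diff_val (tA1 k) (monom k (- 1))))).
    have -> : diff_val (tA1 k) (monom k (- 1)) = monom k 0.
      by apply/laurentP => n; rewrite /= /monom_fun subr_eq addNr.
    have /asboolP [_ hR] : is_dhom predT Gam (dhom_val R) := valP R.
    have /asboolP [_ hL] : is_dhom predT predT (diff_val L) := valP L.
    by apply/hR/hL; rewrite lsupp_monom.
  by move/lsuppP/(_ (j - 1)); case: eqP => // _ /(_ isT); rewrite (negbTE Gj).
have bal : balanced f.
  split=> [R R' w|R w w'|R P w]; first by rewrite /f -lcoefD.
    have [P ->] := gquot_pi_surj w; have [P' ->] := gquot_pi_surj w'.
    by rewrite -gquot_piD !fE -lcoefD -linearD.
  have [P' ->] := gquot_pi_surj w.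
  have -> : P *: (gquot_pi (lideal (tA1_deg k)) P' : V0 k) =
      gquot_pi (lideal (tA1_deg k)) (P * P' : greg (gDiff k predT)).
    exact: gquot_scale_pi.
  by rewrite !fE.
have := tliftE [:: (Q : U, V0_gen)] bal; rewrite big_seq1 /= fE /= QE => tE Q0.
move: tE; rewrite -/(tens1 _ _) -/(infty_tens Q) Q0 -tens0 tliftE // big_nil.
rewrite -(addrC (- 1)) hop_monom => /esym /eqP; exact/negP.
Qed.

Lemma weighted_M_infty : exists e,
  weighted (M := twist (M_infty k Gam) 1) 0 (fun i => ~~ memZ Gam i) e.
Proof.
have [Dl Dr bal] := tens1_balanced U (V0 k).
apply: (@weighted_of_operators (twist (M_infty k Gam) 1) predT infty_tens 0 (- 1)).
- by move=> P Q; exact: Dl.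
- exact: infty_tens_act.
- move=> j Q Qj; rewrite /= /twist_deg addrA subrr add0r.
  exists [:: (Q : U, V0_gen)]; last by rewrite big_seq1.
  move=> p; rewrite inE => /eqP ->; exists j, 0; split=> //=; first exact: addr0.
  by exists 1 => //; rewrite -(scale1r (1 : gDiff k predT)); exact: gr_degA.
- move=> j x; rewrite /= /twist_deg addrA subrr add0r => -[s hs ->].
  rewrite big_seq; apply: (big_ind (fun x => exists2 Q : dhom k predT Gam, homT j (dhom_val Q) & x = infty_tens Q)).
  + by exists 0; [exact: homT_zero | rewrite /infty_tens tens1_0l].
  + move=> _ _ [Q Qj ->] [Q' Qj' ->]; exists (Q + Q'); first exact: homT_add.
    by rewrite /infty_tens Dl.
  + move=> [Q w] /hs /= [i [i' [<- Qi [R Ri ->]]]].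
    exists (dhom_ract Q R); first exact: homT_mul.
    rewrite /infty_tens (bal (Q : U)); congr tens1.
    apply/esym; apply: etrans (gquot_scale_pi _ _ _) _; congr gquot_pi; exact: mulr1.
- by move=> j Q phi QE; rewrite add0r => p0; apply: (infty_tens_eq0 QE); left.
- move=> j; have [_ _ [c hc]] := hGam.
  have [chi [cadm croot _]] := minimal_admissible k_char0 predT j hc.
  move/is_dhom_hop: cadm => hQ; exists (Dhom hQ), chi; split=> //.
  by rewrite add0r; apply/eqP => /croot [m [/k_char0 <-]].
- move=> j Q phi QE; rewrite add0r (addrC (- 1)) => p0; split=> [|Q0].
    exact: infty_tens_neq0 QE p0.
  by apply/negP => Gj; apply: Q0; apply: (infty_tens_eq0 QE); right.
- by move=> i i' m Gi _; rewrite add0r => /k_char0 <- ; rewrite (negbTE Gi).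
- by exists (- 1).
Qed.

(** * The extensions between the simple modules *)

Lemma symbol_shift : exists c : nat, memZ Gam c /\
  forall l : int, c%:Z <= l -> exists P, symbol (Gam := Gam) P l (1 : {poly k}).
Proof.
have [c hc] := memZ_conductor; exists c; split=> [|l cl]; first by apply: hc.
apply: symbol_ex => -[n|n] //= Gn /negP; case; apply: hc; lia.
Qed.

Section WeightCases.
Variables (M N : gmod D) (e : int -> M) (e' : int -> N).
Let notG (i : int) := ~~ memZ Gam i.

(** The operators of degree - l leave A, and t ^ l brings them back; at weight 0 the
    product has a simple zero, since 0 - l is not in Gam. *)
Lemma Ext1_zero_zero : weighted (M := M) 0 (memZ Gam) e -> Ext1_zero M M.
Proof.
move=> W; have [c [_ tr]] := symbol_shift.
have [P [chi [hP _ cm]]] := symbol_minimal (- c.+1%:Z).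
have [Q hQ] : exists Q, symbol (Gam := Gam) Q (- (- c.+1%:Z)) (1 : {poly k}).
  by apply: tr; lia.
have [|c0 c1] := cm 0 memZ0; first by rewrite add0r.
apply: (weighted_self_Ext1_zero W memZ0 _ hP hQ).
- by rewrite add0r.
- by rewrite comp_polyC mul1r addr0.
- by rewrite comp_polyC mul1r addr0.
move=> j R /deg_symbol [phi hR] Sj Re.
have p0 := w_kill W hR memZ0 Sj Re.
have [|R' [_ [_ RE _]]] := euler_factor hR p0; last by exists R'.
by move=> m; rewrite add0r => /k_char0 <-.
Qed.

(** With l - 1 in Gam, t ^ l sends the weight -1 of T / A into A, and the operators of
    degree - l bring it back, with a simple zero at the forbidden transition l - 1 |-> -1. *)
Lemma Ext1_infty_infty : weighted (M := M) 0 notG e -> Ext1_zero M M.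
Proof.
move=> W; have [c [Gc tr]] := symbol_shift.
have [P hP] : exists P, symbol (Gam := Gam) P (c.+1%:Z) (1 : {poly k}) by apply: tr; lia.
have [Q [chi [hQ _ cm]]] := symbol_minimal (- c.+1%:Z).
have cE : - 1 + c.+1%:Z = c%:Z by lia.
have [|c0 c1] := cm c%:Z Gc; first by rewrite intS opprD addrCA subrr.
have Sb : notG (- 1) by [].
apply: (weighted_self_Ext1_zero W Sb _ hP hQ).
- by rewrite /notG cE negbK.
- by rewrite mulr1 horner_comp hornerD hornerX hornerC add0r -intrD cE.
- rewrite mulr1 deriv_comp derivD derivX derivC addr0 mulr1.
  by rewrite horner_comp hornerD hornerX hornerC add0r -intrD cE.
move=> j R /deg_symbol [phi hR] Sj Re.
have p0 := w_kill W hR Sb Sj Re.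
have [|R' [_ [_ RE _]]] := euler_factor hR p0; last by exists R'.
by move=> m; rewrite add0r => /k_char0 <-.
Qed.

(** Here Delta(phi) = phi'(0): the extension is the subquotient (A + eps T) / eps A of
    t ^ eps T, with T = k[t, t^-1] and eps ^ 2 = 0, where t ^ j phi(E) acts on t ^ eps
    through phi(eps). *)
Lemma Ext1_zero_infty : weighted (M := M) 0 (memZ Gam) e ->
  weighted (M := N) 0 notG e' -> Ext1_isom_k M N.
Proof.
move=> WM WN; have G0 := memZ0.
apply: (@weighted_complementary_Ext1 _ k_char0 Gam M N 0 _ _ e e' 0 (- 1)
  (fun p => p^`().[0]) WM WN) => //.
- by rewrite /notG memZ0.
- by move=> p q; rewrite derivD hornerD.
- move=> i j P Q phi psi hP hQ Qe; rewrite add0r.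
  have psi0 : psi.[0] = 0.
    have [Gj|Gj] := boolP (memZ Gam j); last first.
      by apply: (symbol_adm hQ G0); rewrite add0r.
    have := w_kill WM hQ G0 _ Qe; rewrite add0r addr0; exact.
  have -> : ((phi \Po ('X + j%:~R%:P)) * psi)^`().[0] = psi^`().[0] * phi.[j%:~R].
    rewrite derivM hornerD !hornerM psi0 mulr0 add0r horner_comp !hornerE.
    exact: mulrC.
  rewrite -scalarA; congr (_ *: _).
  have [Gj|Gj] := boolP (memZ Gam j); last by rewrite (w_act WN hP Gj) add0r.
  rewrite (w_out WN (i := j)) ?scaler0; last by rewrite /notG negbK.
  have [Gi|Gi] := boolP (memZ Gam (j + i)); last by rewrite (symbol_adm hP Gj Gi) scale0r scale0r.
  by rewrite (w_out WN) ?scaler0 // /notG negbK.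
- move=> V W v w hV hW.
  have [v1 [vE v1E]] : exists q, v = q * ('X - 0%:P) /\ v^`().[0] = q.[0].
    by apply: poly_factor; exact: (symbol_adm hV G0).
  have [w1 [wE w1E]] : exists q, w = q * ('X - 0%:P) /\ w^`().[0] = q.[0].
    by apply: poly_factor; exact: (symbol_adm hW G0).
  exists v1, w1; split; [by rewrite vE wE; ring | by rewrite addr0 v1E | by rewrite addr0 w1E].
- have [P [chi [hP _ cm]]] := symbol_minimal (0 - 1 : int).
  by exists P, chi; split=> //; have [] := cm 0 G0.
Qed.

(** Here Delta(phi) = phi(-1): the extension is T = k[t, t^-1] itself, with
    submodule A and quotient T / A. *)
Lemma Ext1_infty_zero : weighted (M := M) 0 notG e ->
  weighted (M := N) 0 (memZ Gam) e' -> Ext1_isom_k M N.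
Proof.
move=> WM WN; have Sb : notG (- 1) by [].
apply: (@weighted_complementary_Ext1 _ k_char0 Gam M N 0 _ _ e e' (- 1) 0
  (fun p => p.[(- 1)%:~R]) WM WN) => //.
- exact: memZ0.
- by rewrite /notG memZ0.
- by move=> p q; rewrite hornerD.
- move=> i j P Q phi psi hP hQ Qe.
  have -> : ((phi \Po ('X + j%:~R%:P)) * psi).[(- 1)%:~R] =
      psi.[(- 1)%:~R] * phi.[(- 1 + j)%:~R].
    by rewrite hornerM horner_comp hornerD hornerX hornerC -intrD mulrC.
  rewrite -scalarA.
  have [Gj|Gj] := boolP (memZ Gam (- 1 + j)); first by rewrite (w_act WN hP Gj) add0r.
  have := w_kill WM hQ Sb Gj Qe; rewrite add0r => ->.
  by rewrite !scale0r.
- by move=> V W v w _ _; exists v, w; rewrite add0r mulrC.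
- have [|P [phi [hP p0]]] := @symbol_transition (- 1)%:~R (0 - (- 1) : int).
    by move=> m /k_char0 <-.
  by exists P, phi.
Qed.
End WeightCases.
End SimpleModules.

Lemma complex_intr_inj (R : realType) : injective (fun n : int => n%:~R : R[i]).
Proof. exact: intr_inj. Qed.

Lemma Jstar_not_int (R : realType) (a : R[i]) : Jstar a -> forall m : int, a != m%:~R.
Proof.
move=> /andP [/andP [a0 a1] an0] m; apply: contra_not_neq (elimN eqP an0) => am.
move: a0 a1; rewrite am -(rmorph_int (real_complex R)) /= ler0z ltrz1 => m0 m1.
by have -> : m = 0 by lia.
Qed.

Definition index_weight (R : realType) (i : simple_index R) : R[i] :=
  if i is index_star a _ then a else 0.

Definition index_support (R : realType) (Gam : pred nat) (i : simple_index R) : pred int :=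
  match i with
  | index_zero => memZ Gam
  | index_infty => fun n => ~~ memZ Gam n
  | index_star _ _ => predT
  end.

Lemma weighted_simple_module (R : realType) (Gam : pred nat) (i : simple_index R) :
  numerical_semigroup Gam ->
  exists e, weighted (M := simple_module Gam i) (index_weight i) (index_support Gam i) e.
Proof.
move=> hGam; case: i => [||a Ha] /=.
- by eexists; exact: weighted_M_zero (@complex_intr_inj R) _ hGam.
- exact: weighted_M_infty (@complex_intr_inj R) _ hGam.
- exact: weighted_M_alpha (@complex_intr_inj R) _ hGam _ (Jstar_not_int Ha).
Qed.

Theorem proposition12 (R : realType) (Gam : pred nat)
    (hGam : numerical_semigroup Gam) (alpha beta : simple_index R) :
  (forall X : gext (simple_module Gam alpha) (simple_module Gam beta),
     finite_length (ext_mid X)) /\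
  (if ext_nonzero alpha beta
   then Ext1_isom_k (simple_module Gam alpha) (simple_module Gam beta)
   else Ext1_zero (simple_module Gam alpha) (simple_module Gam beta)).
Proof.
have k0 := @complex_intr_inj R.
have [e We] := weighted_simple_module alpha hGam.
have [e' We'] := weighted_simple_module beta hGam.
split; first by move=> X; exact: weighted_finite_length We We' X.
have eigen : index_weight alpha != index_weight beta ->
    Ext1_zero (simple_module Gam alpha) (simple_module Gam beta).
  exact: weighted_Ext1_zero_eigen We We'.
case: alpha beta e We e' We' eigen => [||a Ha] [||c Hc] e We e' We' eigen /=.
- exact: Ext1_zero_zero k0 _ hGam _ _ We.
- exact: Ext1_zero_infty k0 _ hGam _ _ _ _ We We'.
- by apply: eigen; rewrite eq_sym; case/andP: (Hc).
- exact: Ext1_infty_zero k0 _ hGam _ _ _ _ We We'.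
- exact: Ext1_infty_infty k0 _ hGam _ _ We.
- by apply: eigen; rewrite eq_sym; case/andP: (Hc).
- by apply: eigen; case/andP: (Ha).
- by apply: eigen; case/andP: (Ha).
- case: eqVneq => [ac|ac]; last exact: eigen.
  rewrite -ac /=; exact: weighted_generic_Ext1 k0 _ _ _ _ We (Jstar_not_int Ha).
Qed.
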